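(* Let $d\ge 1$ and let $q$ be a power of an odd prime. Let $\mathcal{G}=(V,E)$ be a distance graph with vertices $V=\{v_1,\dots,v_n\}$, $m\ge 1$ edges, and maximum vertex degree $t$. Let $A\subseteq\mathbf{F}_q^d$ with $|A|=\alpha q^d$ and \[ \alpha \geq 4 m q^{t-\frac{d+1}{2}}. \] Then \[ \Big| \mathcal{N}_{\mathcal{G}}(A) - \alpha^n \Big| \leq 4 m\, \alpha^{n-1} q^{t-\frac{d+1}{2}}, \] where \[ \mathcal{N}_{\mathcal{G}}(A) := \mathbf{E}_{x_1,\dots,x_n} \prod_{i=1}^n \Big( 1_A(x_i) \prod_{j=i+1}^n \sigma_{i,j}(x_i-x_j) \Big). \]
   Context: $\mathbf{F}_q$ is the finite field with $q$ elements (odd characteristic). For $x\in\mathbf{F}_q^d$, $|x|^2 := \sum_{j=1}^d x_j^2$. A distance graph is a finite simple graph $\mathcal{G}=(V,E)$ together with a nonzero length $\lambda_e\in\mathbf{F}_q^*$ for each edge $e\in E$; the edge joining $v_i$ and $v_j$ is denoted $e_{i,j}$. For $\lambda\in\mathbf{F}_q$, $\sigma_\lambda(x):=q$ if $|x|^2=\lambda$ and $0$ otherwise. Define $\sigma_{i,j}(x) := \sigma_{\lambda_{e_{i,j}}}(x)$ if $v_i$ and $v_j$ are adjacent, and $\sigma_{i,j}(x):=1$ otherwise. For $f:\mathbf{F}_q^d\to\mathbf{C}$, $\mathbf{E}_x f(x):=q^{-d}\sum_{x\in\mathbf{F}_q^d}f(x)$, and $\mathbf{E}_{x_1,\dots,x_n}:=\mathbf{E}_{x_1}\cdots\mathbf{E}_{x_n}$.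 $1_A$ is the indicator function of $A$. *)

(* Defs.v *)
From HB Require Import structures.
From mathcomp Require Import all_boot all_order all_algebra all_field.
Set Implicit Arguments. Unset Strict Implicit. Unset Printing Implicit Defensive.
Import Order.TTheory GRing.Theory Num.Theory.
Local Open Scope ring_scope.

Definition sqnorm (F : finFieldType) (d : nat) (x : 'rV[F]_d) : F :=
  \sum_(j < d) x ord0 j ^+ 2.

Definition sigma (F : finFieldType) (d : nat) (lam : F) (x : 'rV[F]_d) : algC :=
  if sqnorm x == lam then (#|F|%:R : algC) else 0.

Definition distance_graph (F : finFieldType) (n : nat)
  (adj : rel 'I_n) (len : 'I_n -> 'I_n -> F) : Prop :=
  [/\ (forall i, ~~ adj i i), (forall i j, adj i j = adj j i),
      (forall i j, adj i j -> len i j = len j i) &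
      (forall i j, adj i j -> len i j != 0)].

Definition sigma_ij (F : finFieldType) (d n : nat)
  (adj : rel 'I_n) (len : 'I_n -> 'I_n -> F) (i j : 'I_n) (x : 'rV[F]_d) : algC :=
  if adj i j then sigma (len i j) x else 1.

Definition num_edges (n : nat) (adj : rel 'I_n) : nat :=
  #|[set p : 'I_n * 'I_n | (p.1 < p.2)%N && adj p.1 p.2]|.

Definition degree (n : nat) (adj : rel 'I_n) (i : 'I_n) : nat :=
  #|[set j | adj i j]|.

Definition max_degree (n : nat) (adj : rel 'I_n) : nat :=
  \max_(i < n) degree adj i.

Definition NG (F : finFieldType) (d n : nat)
  (adj : rel 'I_n) (len : 'I_n -> 'I_n -> F) (A : {set 'rV[F]_d}) : algC :=
  (#|F|%:R ^- (d * n)) *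
  \sum_(x : {ffun 'I_n -> 'rV[F]_d})
     \prod_(i < n) ((x i \in A)%:R *
        \prod_(j < n | (i < j)%N) sigma_ij adj len i j (x i - x j)).

(* Main.v *)
Require Import Defs.
From HB Require Import structures.
From mathcomp Require Import all_boot all_order all_algebra all_field.
From mathcomp Require Import all_fingroup all_solvable all_character.
From mathcomp Require Import ring zify.
Set Implicit Arguments. Unset Strict Implicit. Unset Printing Implicit Defensive.
Import Order.TTheory GRing.Theory Num.Theory FinRing.Theory.
Local Open Scope ring_scope.

(** Removing the edge ij changes the normalised count by a bilinear form in the
    weights at x_i and x_j with kernel [sigma - 1].  Its operator norm is the
    largest Fourier coefficient of [sigma - 1], which factors as G^d times a
    Kloosterman sum (d even) or a Salié sum (d odd), G being the quadratic Gauss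
    sum; hence it is at most 2 q^(-(d-1)/2).  The other edges at i and j
    contribute at most q^(t-1), and what remains is the count for the graph with
    i or j deleted, at most 2 alpha^(n-1) by induction on the number of edges.

    Salié sums are evaluated explicitly.  For Kloosterman sums K the Weil bound
    |K| <= 2 sqrt q is proved as follows.  Over the quadratic extension the sum
    becomes 2q - K^2; so if |K| > 2 sqrt q, along the tower of the extensions of
    degree 2^k the normalised sums tend to minus infinity.  On the other hand
    the sum of K(ca, cb) over c in F_q counts the points of y^q - y = ax + b/x,
    that is, the squares among the values of (y^q - y)^2 - 4ab, and Stepanov's
    method in Bombieri's form bounds this count from below; as each K(ca, cb), being
    of the form 2q' - K'^2, is at most twice the root of the field size, each is
    bounded from below as well. *)

(** * Additive characters and the quadratic character *)

Section AdditiveCharacters.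
Variable F : finFieldType.

Definition add_char (psi : F -> algC) : Prop :=
  [/\ {morph psi : x y / x + y >-> x * y}, (forall x, `|psi x| = 1) &
      exists x, psi x != 1].

(** The additive group is abelian, so its irreducible characters are linear; there are [#|F|] of
    them, hence one besides the trivial one. *)
Lemma add_char_exists : exists psi, add_char psi.
Proof.
have abF : abelian [set: F]%G by apply: zmod_abelian.
have /char_abelianP lin := abF.
have F1 : (1 < #|F|)%N by apply: finNzRing_gt1.
have [i ni0] : exists i : Iirr [set: F]%G, i != 0.
  move: abF; rewrite card_classes_abelian => /eqP cl.
  have NF : Nirr [set: F]%G = #|F| by rewrite NirrE cl cardsT.
  have h : (1 < Nirr [set: F]%G)%N by rewrite NF.
  by exists (Ordinal (h : (1 < (pred_Nirr [set: F]%G).+1)%N)).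
exists 'chi_i; split.
- by move=> x y; rewrite -(lin_charM (lin i)) ?inE.
- by move=> x; rewrite (normC_lin_char (lin i)) ?inE.
have [/existsP[x]|] := boolP [exists x, 'chi_i x != 1]; first by exists x.
rewrite negb_exists => /forallP h; case/negP: ni0; apply/eqP/irr_inj.
rewrite irr0; apply/cfunP=> x; rewrite cfun1E inE.
by have := h x; rewrite negbK => /eqP.
Qed.

Variable psi : F -> algC.
Hypothesis psiP : add_char psi.

Lemma add_charD x y : psi (x + y) = psi x * psi y.
Proof. by case: psiP => h _ _; apply: h. Qed.

Lemma norm_add_char x : `|psi x| = 1.
Proof. by case: psiP. Qed.

Lemma add_char_neq0 x : psi x != 0.
Proof. by rewrite -normr_eq0 norm_add_char oner_neq0. Qed.

Lemma add_char0 : psi 0 = 1.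
Proof. by apply: (mulfI (add_char_neq0 0)); rewrite -add_charD addr0 mulr1. Qed.

Lemma add_charN x : psi (- x) = (psi x)^*.
Proof.
apply: (mulfI (add_char_neq0 x)).
by rewrite -add_charD subrr add_char0 -normCK norm_add_char expr1n.
Qed.

Lemma add_char_sum (I : Type) (r : seq I) (P : pred I) (f : I -> F) :
  psi (\sum_(i <- r | P i) f i) = \prod_(i <- r | P i) psi (f i).
Proof. exact: (big_morph psi add_charD add_char0). Qed.

(** For [a] nonzero, translating [x] by [y / a] multiplies the sum by [psi y], which differs from 1
    for a suitable [y]. *)
Lemma sum_add_char a : \sum_x psi (a * x) = (a == 0)%:R * #|F|%:R.
Proof.
have [->|a0] := eqVneq a 0.
  by under eq_bigr do rewrite mul0r add_char0; rewrite sumr_const mul1r.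
case: psiP => _ _ [y psiy]; rewrite mul0r.
apply/eqP; rewrite -(mulrI_eq0 _ (@mulfI _ (psi y - 1) _)) ?subr_eq0 //.
rewrite mulrBl mul1r subr_eq0 mulr_sumr; apply/eqP.
rewrite [RHS](reindex_inj (addIr (y / a))); apply: eq_bigr => x _.
by rewrite mulrDr mulrCA mulfV // mulr1 add_charD mulrC.
Qed.

End AdditiveCharacters.

(** * Euler's criterion and the quadratic character *)

Section Squares.
Variable F : finFieldType.
Hypothesis two0 : (2 : F) != 0.
Let h := (#|F|./2)%N.

(** By Cauchy's theorem an even order would give an element of additive order 2, which [two0]
    excludes. *)
Lemma card_odd_field : odd #|F|.
Proof.
apply/negPn/negP; rewrite -dvdn2 -cardsT => ev.
have [x _ ox] := Cauchy (isT : prime 2) ev.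
have : (x ^+ 2)%g = 1%g by rewrite -ox expg_order.
rewrite zmodXgE -mulr_natl => /eqP; rewrite mulf_eq0 (negPf two0) /= => /eqP x0.
by move: ox; rewrite x0 order1.
Qed.

Lemma card_halfK : (#|F| = h.*2.+1)%N.
Proof. by rewrite -[LHS]odd_double_half card_odd_field. Qed.

Lemma exp_half_sqr (x : F) : x != 0 -> (x ^+ h) ^+ 2 = 1.
Proof.
move=> x0; apply: (mulfI x0); rewrite -exprM muln2 -exprS -card_halfK.
by rewrite expf_card mulr1.
Qed.

Lemma exp_halfP (x : F) : x != 0 -> (x ^+ h == 1) || (x ^+ h == -1).
Proof. by move/exp_half_sqr/eqP; rewrite sqrf_eq1. Qed.

Lemma one_neq_opp : (1 : F) != -1.
Proof. by rewrite -subr_eq0 opprK -[1 + 1]/(2 : F). Qed.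

Lemma exists_generator :
  exists g : F, [/\ g != 0, g ^+ h = -1 &
                    forall x : F, x != 0 -> exists i, x = g ^+ i].
Proof.
have F1 := finNzRing_gt1 F; have cF := card_halfK.
have h0 : (0 < #|F|.-1)%N by rewrite -ltnS prednK // ltnW.
have U (x : F) : x != 0 -> x ^+ #|F|.-1 = 1.
  by move=> x0; rewrite cF /= -muln2 exprM exp_half_sqr.
have := @cyclic.has_prim_root _ _ (enum (predC1 (0 : F))) h0.
case/(_ _ (enum_uniq _) _)/hasP.
- by apply/allP => x; rewrite mem_enum inE => /U e; rewrite unity_rootE e.
- by rewrite -cardE cardC1.
move=> g _ pg.
have g0 : g != 0.
  apply/eqP => g0; move/eqP: (prim_expr_order pg).
  by rewrite g0 expr0n gtn_eqF // eq_sym oner_eq0.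
exists g; split=> //.
  have /orP[|/eqP //] := exp_halfP g0.
  rewrite -(prim_order_dvd pg) => /dvdn_leq; move: h0.
  rewrite cF /= -addnn; case: (h) => // k _ /(_ isT).
  by rewrite addSn ltnNge leq_addl.
move=> x /U /(prim_rootP pg) [i ->]; by exists i.
Qed.

(** Odd powers of a generator have [h]-th power -1, so [x] is an even power. *)
Lemma exp_half_square (x : F) : x != 0 -> x ^+ h = 1 -> exists y, x = y ^+ 2.
Proof.
have [g [_ eg gen]] := exists_generator => /gen [i ->].
rewrite -exprM mulnC exprM => e.
move: e; rewrite eg -signr_odd; case: (boolP (odd i)) => [_|ev _].
  by rewrite expr1 => /esym/eqP; rewrite (negPf one_neq_opp).
by exists (g ^+ i./2); rewrite -exprM muln2 -[in LHS](odd_double_half i) (negPf ev).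
Qed.

(** The quadratic character; the value 0 at 0 makes [1 + eta t] the number of square roots of every
    [t]. *)
Definition eta (x : F) : algC :=
  if x == 0 then 0 else if x ^+ h == 1 then 1 else -1.

Lemma eta0 : eta 0 = 0. Proof. by rewrite /eta eqxx. Qed.

Lemma eta_nsq (x : F) : x ^+ h = -1 -> eta x = -1.
Proof.
move=> e; rewrite /eta e [-1 == 1]eq_sym (negPf one_neq_opp); case: eqP => // x0.
move: e; rewrite x0 expr0n; case: (h == 0)%N => /eqP.
  by rewrite (negPf one_neq_opp).
by rewrite eq_sym oppr_eq0 oner_eq0.
Qed.

Lemma etaM x y : eta (x * y) = eta x * eta y.
Proof.
have [->|x0] := eqVneq x 0; first by rewrite mul0r eta0 mul0r.
have [->|y0] := eqVneq y 0; first by rewrite mulr0 eta0 mulr0.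
rewrite /eta mulf_eq0 (negPf x0) (negPf y0) /= exprMn.
have := one_neq_opp; rewrite eq_sym => /negPf n1.
case/orP: (exp_halfP x0) => /eqP ->; case/orP: (exp_halfP y0) => /eqP ->;
  by rewrite ?n1 ?eqxx ?mulrNN ?mulr1 ?mul1r ?mulrN ?mulNr ?opprK ?mulr1 ?n1 ?eqxx.
Qed.

Lemma eta_sqr x : x != 0 -> eta x * eta x = 1.
Proof. by rewrite /eta => /negPf->; case: ifP => _; rewrite ?mulrNN mulr1. Qed.

Lemma norm_eta x : x != 0 -> `|eta x| = 1.
Proof. by rewrite /eta => /negPf->; case: ifP => _; rewrite ?normrN normr1. Qed.

Lemma exists_nonsquare :
  exists nu : F, [/\ nu != 0, nu ^+ h = -1, eta nu = -1 & forall y, y ^+ 2 != nu].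
Proof.
have [g [g0 gh _]] := exists_generator.
exists g; split=> //; first exact: eta_nsq.
move=> y; apply: contraNneq one_neq_opp => yg; rewrite -gh -yg -exprM mulnC exprM.
by rewrite exp_half_sqr //; apply: contraNneq g0 => y0; rewrite -yg y0 expr0n.
Qed.

Lemma card_sqrt (t : F) : #|[set y | y ^+ 2 == t]|%:R = 1 + eta t.
Proof.
rewrite /eta; have [->|t0] := eqVneq t 0.
  rewrite addr0; rewrite (_ : [set y | _] = [set 0]) ?cards1 //.
  by apply/setP => y; rewrite !inE sqrf_eq0.
have [th|th] := eqVneq (t ^+ h) 1.
  have [z tz] := exp_half_square t0 th.
  have z0 : z != 0 by apply: contraNneq t0 => z0; rewrite tz z0 expr0n.
  rewrite (_ : [set y | _] = [set z; - z]); last first.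
    by apply/setP => y; rewrite !inE tz eqf_sqr.
  have zN : z != - z by rewrite -subr_eq0 opprK -mulr2n -mulr_natl mulf_neq0.
  by rewrite cards2 zN.
rewrite subrr (_ : [set y | _] = set0) ?cards0 //.
apply/setP => y; rewrite !inE; apply/negbTE; apply: contraNneq th => yt.
rewrite -yt -exprM mulnC exprM exp_half_sqr ?eqxx //.
by apply: contraNneq t0 => y0; rewrite -yt y0 expr0n.
Qed.

Lemma sum_square (Phi : F -> algC) :
  \sum_v Phi (v ^+ 2) = \sum_t (1 + eta t) * Phi t.
Proof.
rewrite (partition_big (fun v : F => v ^+ 2) xpredT) //=; apply: eq_bigr => t _.
rewrite (eq_bigr (fun=> Phi t)); last by move=> v /eqP->.
rewrite sumr_const -mulr_natl -card_sqrt; congr (_%:R * _).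
by apply: eq_card => v; rewrite !inE.
Qed.

(** The values [v ^+ 2] and [nu * v ^+ 2] together cover each [t] exactly twice:
    [(1 + eta t) + (1 - eta t) = 2]. *)
Lemma sum_square_twist (Phi : F -> algC) nu : nu != 0 -> eta nu = -1 ->
  \sum_v Phi (v ^+ 2) + \sum_v Phi (nu * v ^+ 2) = 2 * \sum_t Phi t.
Proof.
move=> nu0 enu; rewrite (sum_square Phi) (sum_square (fun t => Phi (nu * t))).
rewrite [X in X + _](reindex_inj (mulfI nu0)) -big_split /=.
rewrite [in RHS](reindex_inj (mulfI nu0)) mulr_sumr; apply: eq_bigr => t _.
by rewrite etaM enu; ring.
Qed.

End Squares.

(** * Gauss and Salié sums *)

Section GaussSums.
Variables (F : finFieldType) (psi : F -> algC).
Hypotheses (two0 : (2 : F) != 0) (psiP : add_char psi).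
Let D := add_charD psiP.
Let q : algC := #|F|%:R.

Definition gauss := \sum_t eta t * psi t.

Lemma sum_add_char_sqr s : s != 0 -> \sum_x psi (s * x ^+ 2) = eta s * gauss.
Proof.
move=> s0; rewrite (sum_square two0 (fun t => psi (s * t))).
under eq_bigr do rewrite mulrDl mul1r.
rewrite big_split /= sum_add_char // (negPf s0) mul0r add0r /gauss.
rewrite [in RHS](reindex_inj (mulfI s0)) mulr_sumr; apply: eq_bigr => t _.
by rewrite etaM // !mulrA eta_sqr // mul1r.
Qed.

Lemma sum_neq0 (G : F -> algC) : \sum_(x | x != 0) G x = \sum_x G x - G 0.
Proof. by rewrite [in RHS](bigD1 0) //= addrC addrK. Qed.

(** In the squared modulus the substitution [x = u + y] makes the phase [x ^+ 2 - y ^+ 2] linear in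
    [y], so that only [u = 0] survives. *)
Lemma norm_gauss : `|gauss| ^+ 2 = q.
Proof.
have e1 : eta (1 : F) = 1 by rewrite /eta oner_eq0 expr1n eqxx.
have -> : gauss = \sum_x psi (x ^+ 2).
  rewrite -[LHS]mul1r -e1 -sum_add_char_sqr ?oner_neq0 //.
  by apply: eq_bigr => x _; rewrite mul1r.
rewrite normCK rmorph_sum /= mulr_sumr.
transitivity (\sum_y \sum_u psi (u ^+ 2) * psi (2 * u * y)).
  apply: eq_bigr => y _; rewrite mulr_suml (reindex_inj (addIr y)) /=.
  by apply: eq_bigr => u _; rewrite -add_charN // -!D; congr psi; ring.
rewrite exchange_big /= (bigD1 0) //= [X in _ + X]big1 ?addr0 => [|u u0].
  rewrite -mulr_sumr expr0n /= add_char0 // mul1r.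
  by rewrite sum_add_char // mulr0 eqxx mul1r.
by rewrite -mulr_sumr sum_add_char // mulf_eq0 (negPf two0) (negPf u0) mul0r mulr0.
Qed.

Lemma sum_add_char_quadratic s c : s != 0 ->
  \sum_x psi (s * x ^+ 2 + c * x) = eta s * gauss * psi (- (c ^+ 2 / (4 * s))).
Proof.
move=> s0; rewrite -sum_add_char_sqr // mulr_suml.
have f0 : (4 : F) != 0 by rewrite (_ : 4 = 2 * 2) ?mulf_neq0 //; ring.
rewrite (reindex_inj (addIr (- (c / (2 * s))))); apply: eq_bigr => x _.
by rewrite -D; congr psi; field; rewrite s0 two0 f0.
Qed.

Definition salie (a b : F) := \sum_(s | s != 0) eta s * psi (a * s + b / s).

(** Substitute [c * s] for [s]. With [c = - b] the second parameter becomes -1, the value that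
    completing the square in [s * x ^+ 2 + 2 * x] produces. *)
Lemma salie_twist a b c : c != 0 -> salie a b = eta c * salie (a * c) (b / c).
Proof.
move=> c0; rewrite /salie (reindex_inj (mulfI c0)) mulr_sumr.
apply: eq_big => [s|s]; first by rewrite mulf_eq0 (negPf c0).
rewrite mulf_eq0 (negPf c0) /= => s0; rewrite etaM // mulrA.
by congr (_ * psi _); field; rewrite c0 s0.
Qed.

Lemma card_sqrt_le2 (t : F) : (#|[set y | y ^+ 2 == t]| <= 2)%N.
Proof.
rewrite -(ler_nat algC) card_sqrt // -[2]/(1 + 1 : algC) lerD2l.
by rewrite /eta; case: ifP => _ //; case: ifP => _ //; rewrite -subr_ge0 opprK -[1 + 1]/(2%:R) ler0n.
Qed.

Lemma norm_salie_le a b : a != 0 -> `|salie a b| <= 2 * sqrtC q.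
Proof.
move=> a0.
have q0 : 0 < q by rewrite ltr0n; apply: ltnW; apply: finNzRing_gt1.
have gn : `|gauss| = sqrtC q.
  by apply/(@pexpIrn _ 2); rewrite ?nnegrE ?normr_ge0 ?sqrtC_ge0 ?ler0n // norm_gauss sqrtCK.
have sq0 : 0 < sqrtC q by rewrite sqrtC_gt0.
have [->|b0] := eqVneq b 0.
  rewrite (_ : salie a 0 = eta a * gauss).
    rewrite normrM norm_eta // mul1r gn ler_peMl ?(ltW sq0) //.
    by rewrite ler1n.
  rewrite /salie sum_neq0 eta0 mul0r subr0 /gauss mulr_sumr.
  rewrite [in RHS](reindex_inj (mulfI a0)) /=; apply: eq_bigr => s _.
  by rewrite etaM // !mulrA eta_sqr // mul1r mul0r addr0.
have nb0 : - b != 0 by rewrite oppr_eq0.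
rewrite (salie_twist _ _ nb0) normrM norm_eta // mul1r.
rewrite (_ : b / - b = -1); last by rewrite invrN mulrN divff.
set a' := a * - b.
rewrite -(ler_pM2l sq0) mulrCA -expr2 sqrtCK -{1}gn -normrM.
have f0 : (4 : F) != 0 by rewrite (_ : 4 = 2 * 2) ?mulf_neq0 //; ring.
(* [gauss * eta s * psi (- 1 / s)] is the sum of [psi (s * x ^+ 2 + 2 * x)] over [x]; summing over
   [s] first then detects [x ^+ 2 = - a'], which leaves at most two terms. *)
have -> : gauss * salie a' (-1) = q * \sum_(x in [set x | x ^+ 2 == - a']) psi (2 * x).
  transitivity (\sum_(s | s != 0) \sum_x psi (2 * x) * psi (s * (x ^+ 2 + a'))).
    rewrite /salie mulr_sumr; apply: eq_bigr => s s0.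
    transitivity (psi (a' * s) * \sum_x psi (s * x ^+ 2 + 2 * x)).
      rewrite sum_add_char_quadratic // D mulrCA !mulrA; congr (_ * _); last first.
        by congr psi; field; rewrite s0 f0.
      by rewrite mulrC mulrA.
    rewrite mulr_sumr; apply: eq_bigr => x _; rewrite -!D; congr psi; ring.
  rewrite exchange_big /= mulr_sumr.
  (* Adding this zero sum supplies the missing term [s = 0] for each [x]. *)
  have z : \sum_x psi (2 * x) = 0 by rewrite sum_add_char // (negPf two0) mul0r.
  rewrite -[LHS]addr0 -[X in _ + X = _]z -big_split /= [RHS]big_mkcond; apply: eq_bigr => x _.
  rewrite sum_neq0 mul0r add_char0 // mulr1 subrK -mulr_sumr.
  under eq_bigr do rewrite mulrC.
  rewrite sum_add_char // inE -addr_eq0; case: ifP => _; rewrite ?mul0r ?mulr0 //.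
  by rewrite mul1r mulrC.
rewrite normrM ger0_norm ?ler0n // mulrC ler_pM2r //.
apply: le_trans (ler_norm_sum _ _ _) _.
under eq_bigr do rewrite norm_add_char //.
by rewrite sumr_const ler_nat card_sqrt_le2.
Qed.

End GaussSums.

(** * Kloosterman sums under a quadratic extension *)

(** Adjoin a root of ['X^2 - nu]. If two pairs with distinct second coordinates had the same image,
    [nu] would be a square in [F]; injectivity and a count of elements give the bijection. *)
Lemma quadratic_extension (F : finFieldType) (nu : F) :
  (forall y, y ^+ 2 != nu) ->
  exists (E : finFieldType) (iota : {rmorphism F -> E}) (w : E),
    w ^+ 2 = iota nu /\ bijective (fun p : F * F => iota p.1 + iota p.2 * w).
Proof.
move=> nsq; pose p : {poly F} := 'X^2 - nu%:P.
have sp : size p = 3 by rewrite size_XnsubC.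
have irr : irreducible_poly p.
  apply: cubic_irreducible; first by rewrite sp.
  by move=> x; rewrite rootE !hornerE subr_eq0.
have [L dimL [z rz _]] := irredp_FAdjoin irr.
pose E : finFieldType := finvect_type L.
pose iota : {rmorphism F -> E} := in_alg L.
have zz : z ^+ 2 = iota nu.
  move: rz; rewrite rootE rmorphB /= map_polyXn map_polyC !hornerE /= subr_eq0.
  by move/eqP.
have inj : injective (fun p : F * F => iota p.1 + iota p.2 * (z : E)).
  case=> [u v] [u' v'] /= e.
  have e' : iota (u - u') = iota (v' - v) * (z : E).
    by rewrite !rmorphB mulrBl; apply/eqP; rewrite subr_eq addrAC -subr_eq opprK addrC e addrC.
  have [vv|vv] := eqVneq v' v.
    move: e'; rewrite vv subrr rmorph0 mul0r => /eqP; rewrite fmorph_eq0 subr_eq0.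
    by move/eqP->.
  have v0 : v' - v != 0 by rewrite subr_eq0.
  have : iota (((u - u') / (v' - v)) ^+ 2) = iota nu.
    by rewrite rmorphXn fmorph_div e' mulrAC mulfV ?fmorph_eq0 // mul1r zz.
  by move/fmorph_inj/eqP; rewrite (negPf (nsq _)).
exists E, iota, z; split=> //; apply: inj_card_bij => //.
rewrite card_prod -(card_vspacef (Vector.class (finvect_type L : vectType F))).
by rewrite card_vspace (dimL : \dim (fullv : {vspace finvect_type L}) = _) sp /= -mulnn.
Qed.

Definition kloosterman (F : finFieldType) (psi : F -> algC) (a b : F) : algC :=
  \sum_(x | x != 0) psi (a * x + b / x).

Lemma kloosterman_real (F : finFieldType) (psi : F -> algC) a b :
  add_char psi -> kloosterman psi a b \is Num.real.
Proof.
move=> psiP; apply/CrealP; rewrite /kloosterman rmorph_sum /=.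
rewrite (reindex_inj oppr_inj) /=; apply: eq_big => x; first by rewrite oppr_eq0.
by move=> _; rewrite -add_charN // mulrN invrN mulrN -opprD opprK.
Qed.

Section QuadraticStep.
Variables (F E : finFieldType) (psi : F -> algC) (nu : F).
Variables (iota : {rmorphism F -> E}) (w : E).
Hypotheses (two0 : (2 : F) != 0) (psiP : add_char psi).
Hypotheses (nu0 : nu != 0) (eta_nu : eta nu = -1) (nsq : forall y, y ^+ 2 != nu).
Hypotheses (w2 : w ^+ 2 = iota nu)
  (bij : bijective (fun p : F * F => iota p.1 + iota p.2 * w)).
Let q : algC := #|F|%:R.

(** Coordinates in the basis [1, w]; bijectivity keeps the default from being reached. *)
Definition coords (z : E) : F * F :=
  odflt (0, 0) [pick p : F * F | iota p.1 + iota p.2 * w == z].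

Lemma coordsK u v : coords (iota u + iota v * w) = (u, v).
Proof.
rewrite /coords; case: pickP => [p /eqP e|/(_ (u, v))]; last by rewrite eqxx.
by apply: (bij_inj bij) => /=.
Qed.

Lemma coords_surj z : exists u v, z = iota u + iota v * w.
Proof. by case: bij => g _ gK; exists (g z).1, (g z).2; rewrite -{1}(gK z). Qed.

(** This is [psi] composed with the trace from [E] to [F], as [iota u + iota v * w] has trace
    [2 * u]. *)
Definition lift_char (z : E) : algC := psi (2 * (coords z).1).

Lemma lift_charE u v : lift_char (iota u + iota v * w) = psi (2 * u).
Proof. by rewrite /lift_char coordsK. Qed.

Lemma lift_add_char : add_char lift_char.
Proof.
split=> [x y|x|]; last 2 first.
- by rewrite /lift_char norm_add_char.
- case: psiP => _ _ [x px]; exists (iota (x / 2)).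
  have -> : iota (x / 2) = iota (x / 2) + iota 0 * w by rewrite rmorph0 mul0r addr0.
  by rewrite lift_charE mulrC divfK.
have [u [v ->]] := coords_surj x; have [u' [v' ->]] := coords_surj y.
have -> : iota u + iota v * w + (iota u' + iota v' * w) =
          iota (u + u') + iota (v + v') * w by rewrite !rmorphD /=; ring.
by rewrite !lift_charE mulrDr add_charD.
Qed.

(** For odd [n], [w ^+ n] is a multiple of [w] by an element of [F], so the [n]-th power acts on
    first coordinates as it does on [F]. *)
Lemma lift_char_frobenius n : [pchar F].-nat n -> odd n ->
  (forall x, psi (x ^+ n) = psi x) -> forall z, lift_char (z ^+ n) = lift_char z.
Proof.
move=> pn on h z; have [u [v ->]] := coords_surj z.
have pnE : [pchar E].-nat n by rewrite (eq_pnat _ (fmorph_pchar iota)).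
rewrite exprDn_pchar // exprMn -(odd_double_half n) on.
have -> : w ^+ (true + n./2.*2) = iota (nu ^+ n./2) * w.
  by rewrite exprS -mul2n exprM w2 rmorphXn mulrC.
rewrite mulrA -!rmorphXn -rmorphM lift_charE lift_charE /=.
rewrite (_ : true + _ = n)%N; last by rewrite -[RHS]odd_double_half on.
rewrite -[RHS]h exprMn; congr (psi (_ * _)).
by rewrite -[2]/(1 + 1) exprDn_pchar // expr1n.
Qed.

Lemma norm_form_neq0 u v : (u, v) != (0, 0) -> u ^+ 2 - nu * v ^+ 2 != 0.
Proof.
apply: contraNneq => /eqP; rewrite subr_eq0 => /eqP e.
have [v0|v0] := eqVneq v 0.
  by move/eqP: e; rewrite v0 expr0n mulr0 sqrf_eq0 => /eqP->.
by have := nsq (u / v); rewrite expr_div_n e mulfK ?eqxx // sqrf_eq0.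
Qed.

(* With x = u + v, y = u - v, both K^2 and the lifted sum run over values of
   the same function of (u, t), at t = v^2 and t = nu v^2 respectively. *)
Lemma kloosterman_lift (a b : F) : a != 0 -> b != 0 ->
  kloosterman lift_char (iota a) (iota b) = 2 * q - kloosterman psi a b ^+ 2.
Proof.
move=> a0 b0; apply/eqP; rewrite eq_sym subr_eq eq_sym; apply/eqP.
pose Phi u t := if u ^+ 2 == t then 0 else psi (2 * a * u + 2 * b * u / (u ^+ 2 - t)).
have KE : kloosterman lift_char (iota a) (iota b) = \sum_u \sum_v Phi u (nu * v ^+ 2).
  rewrite /kloosterman big_mkcond (reindex _ (onW_bij _ bij)) pair_big /=.
  apply: eq_bigr => -[u v] _ /=; rewrite /Phi; case: ifPn => [z0|]; last first.
    rewrite negbK => /eqP z0; have := coordsK u v.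
    rewrite z0 (_ : 0 = iota 0 + iota 0 * w); last by rewrite rmorph0; ring.
    by rewrite coordsK => -[<- <-]; rewrite expr0n mulr0 eqxx.
  have N0 : u ^+ 2 - nu * v ^+ 2 != 0.
    apply: norm_form_neq0; apply: contraNneq z0 => -[-> ->].
    by rewrite rmorph0 mul0r addr0.
  have := N0; rewrite subr_eq0 => /negPf ->.
  set N := u ^+ 2 - nu * v ^+ 2 in N0 *.
  have iN0 : iota N != 0 by rewrite fmorph_eq0.
  have eV : (iota u + iota v * w)^-1 = (iota u - iota v * w) / iota N.
    apply: (mulfI z0); rewrite mulfV // mulrA [X in _ = X / _]mulrC -subr_sqr exprMn w2.
    by rewrite -!rmorphXn -rmorphM -rmorphB (mulrC _ nu) mulfV.
  clearbody N.
  have -> : iota a * (iota u + iota v * w) + iota b / (iota u + iota v * w) =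
            iota (a * u + b * u / N) + iota (a * v - b * v / N) * w.
    rewrite eV.
    rewrite rmorphD rmorphB !rmorphM fmorphV /=; ring.
  by rewrite lift_charE; congr psi; ring.
have KF : kloosterman psi a b ^+ 2 = \sum_u \sum_v Phi u (v ^+ 2).
  rewrite expr2 /kloosterman mulr_suml.
  transitivity (\sum_x \sum_y if (x != 0) && (y != 0)
                  then psi (a * x + b / x) * psi (a * y + b / y) else 0).
    rewrite big_mkcond; apply: eq_bigr => x _; case: ifP => _ /=; last by rewrite big1.
    by rewrite mulr_sumr big_mkcond.
  rewrite !pair_big /=.
  have bj : bijective (fun p : F * F => (p.1 + p.2, p.1 - p.2) : F * F).
    exists (fun p : F * F => ((p.1 + p.2) / 2, (p.1 - p.2) / 2) : F * F) => -[x y] /=;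
      congr pair; by field; rewrite ?two0.
  rewrite (reindex _ (onW_bij _ bj)) /=; apply: eq_bigr => -[u v] _ /=.
  rewrite /Phi -[_ == v ^+ 2]subr_eq0 subr_sqr mulf_eq0 orbC -negb_or.
  case: orP => //= /orP/norP[n1 n2].
  rewrite -add_charD //; congr psi; field.
  by rewrite n1 n2.
rewrite KE KF -big_split /=.
under eq_bigr do rewrite addrC sum_square_twist //.
rewrite -mulr_sumr; congr (_ * _).
(* With [n = u ^+ 2 - t] the phase becomes linear in [u]; the sum over [u] vanishes unless
   [n = - b / a], where it is [q]. *)
transitivity (\sum_n \sum_u if n == 0 then 0 else psi ((2 * (a + b / n)) * u)).
  rewrite [RHS]exchange_big; apply: eq_bigr => u _ /=.
  have inj : injective (fun n => u ^+ 2 - n) by move=> x y /addrI/oppr_inj.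
  rewrite [LHS](reindex_inj inj); apply: eq_bigr => n _; rewrite /Phi -[u ^+ 2 == _]subr_eq0 subKr.
  case: ifPn => // n0.
  by congr psi; field.
rewrite (bigD1 (- b / a)) //= [X in _ + X]big1 => [|n nb].
  rewrite mulf_eq0 oppr_eq0 invr_eq0 (negPf a0) (negPf b0) addr0.
  have -> : a + b / (- b / a) = 0 by field; rewrite ?a0 ?b0 ?oppr_eq0 ?b0.
  by rewrite sum_add_char // mulr0 eqxx mul1r.
have [_|n0] := eqVneq n 0; first by rewrite big1.
rewrite sum_add_char // mulf_eq0 (negPf two0) /=; case: eqP; rewrite ?mul0r // => e.
case/eqP: nb; apply: (mulIf a0); rewrite mulfVK //; apply/eqP.
rewrite -addr_eq0; apply/eqP; rewrite -[RHS](mulr0 n) -e; field.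
by rewrite n0.
Qed.
End QuadraticStep.

Lemma pchar_nat_card (F : finFieldType) : [pchar F].-nat #|F|.
Proof.
have [p pr pF] := finPcharP F; rewrite (eq_pnat _ (pcharf_eq pF)).
by rewrite -cardsT; have := fin_ring_pchar_abelem pF => /abelem_pgroup.
Qed.

Lemma card_quadratic (F E : finFieldType) (f : F * F -> E) :
  bijective f -> #|E| = (#|F| ^ 2)%N.
Proof. by move/bij_eq_card; rewrite card_prod mulnn => ->. Qed.

(** The sum over the extension of degree [2 ^ k], as [kloosterman_lift] prescribes it; [q ^ 2 ^ k']
    is the size of the field one level below. *)
Fixpoint kloosterman_iter (q : nat) (K : algC) (k : nat) : algC :=
  if k is k'.+1 then 2 * (q ^ 2 ^ k')%:R - kloosterman_iter q K k' ^+ 2 else K.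

(** The invariance of [chi] under the power [#|F|] of the base field is carried along because it
    makes [chi] trivial on [iota c * (y ^+ #|F| - y)] for [c] in [F]. *)
Lemma kloosterman_tower (F : finFieldType) (psi : F -> algC) (k : nat) :
  (2 : F) != 0 -> add_char psi ->
  exists (E : finFieldType) (iota : {rmorphism F -> E}) (chi : E -> algC),
  [/\ #|E| = (#|F| ^ 2 ^ k)%N, add_char chi, forall y, chi (y ^+ #|F|) = chi y &
   forall a b : F, a != 0 -> b != 0 -> kloosterman chi (iota a) (iota b) =
     kloosterman_iter #|F| (kloosterman psi a b) k].
Proof.
move=> two0 psiP; elim: k => [|k [E [iota [chi [cE chiP frob HK]]]]].
  exists F, idfun, psi; split=> // y; by rewrite expf_card.
have two0E : (2 : E) != 0 by rewrite -(rmorph_nat iota) fmorph_eq0.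
have [nu [nu0 _ enu nsq]] := exists_nonsquare two0E.
have [L [kappa [w [w2 bij]]]] := quadratic_extension nsq.
exists L, (kappa \o iota), (lift_char chi kappa w); split.
- by rewrite (card_quadratic bij) cE -expnM -expnSr.
- exact: lift_add_char.
- apply: (lift_char_frobenius w2 bij) => //; last exact: card_odd_field.
  by rewrite (eq_pnat _ (fmorph_pchar iota)) pchar_nat_card.
move=> a b a0 b0; rewrite /= (kloosterman_lift two0E chiP nu0) ?fmorph_eq0 //.
by rewrite HK // cE.
Qed.

(** * Stepanov's method *)

(** The matrix of coefficients has more rows than columns, hence a nonzero left kernel vector. *)
Lemma poly_linear_dependency (K : fieldType) (I : finType) (T : I -> {poly K}) (N : nat) :
  (forall i, (size (T i) <= N)%N) -> (N < #|I|)%N ->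
  exists2 u : I -> K, (exists i, u i != 0) & \sum_i u i *: T i = 0.
Proof.
move=> sT NI; pose M : 'M[K]_(#|I|, N) := \matrix_k poly_rV (T (enum_val k)).
have : kermx M != 0.
  by rewrite kermx_eq0 /row_free neq_ltn (leq_ltn_trans (rank_leq_col M) NI).
case/rowV0Pn => v /sub_kermxP vM v0.
exists (fun i => v 0 (enum_rank i)).
  have [k vk] : exists k, v 0 k != 0.
    apply/existsP; apply: contraR v0; rewrite negb_exists => /forallP h.
    by apply/eqP/rowP => k; rewrite mxE; apply/eqP; have := h k; rewrite negbK.
  by exists (enum_val k); rewrite enum_valK.
rewrite (reindex (enum_val (A := I))) /=; last first.
  by exists enum_rank => k _; rewrite ?enum_valK ?enum_rankK.
transitivity (rVpoly (v *m M)); last by rewrite vM linear0.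
rewrite mulmx_sum_row linear_sum; apply: eq_bigr => k _.
by rewrite linearZ /= enum_valK rowK poly_rV_K.
Qed.

Lemma expr_sum_pchar (R : comNzRingType) n (I : Type) (r : seq I) (P : pred I) (G : I -> R) :
  [pchar R].-nat n -> (\sum_(i <- r | P i) G i) ^+ n = \sum_(i <- r | P i) G i ^+ n.
Proof.
move=> pn; apply: (big_morph (fun x => x ^+ n)) => [x y|]; first exact: exprDn_pchar.
by rewrite expr0n; case: n pn.
Qed.

Lemma size_mul_le (R : nzSemiRingType) (g h : {poly R}) (a b : nat) :
  (size g <= a.+1)%N -> (size h <= b.+1)%N -> (size (g * h)%R <= (a + b).+1)%N.
Proof. by move=> ga hb; apply: (leq_trans (size_polyMleq _ _)); lia. Qed.

Section Stepanov.
Variables (E : finFieldType) (S D m e : nat) (f : {poly E}).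
Hypotheses (pS : [pchar E].-nat S) (cE : #|E| = (S * S)%N).
Hypotheses (f0 : f.[0] != 0) (szf : (size f <= D.+1)%N).
Hypothesis f_nsq : forall (c : E) (r s : {poly E}),
  c != 0 -> r ^+ 2 = c *: (f * s ^+ 2) -> s = 0.
Hypotheses (eS : (e + e = S.+1)%N) (mS : (m + m + D <= S.+1)%N).

Lemma expr_pchar_split : exists h, f ^+ S = (f.[0] ^+ S)%:P + 'X^S * h.
Proof.
have pSP : [pchar {poly E}].-nat S by rewrite (eq_pnat _ (@pchar_poly _)).
have /factor_theorem[g fg] : root (f - (f.[0])%:P) 0 by rewrite rootE !hornerE subrr.
exists (g ^+ S); rewrite -[f in LHS](subrK (f.[0])%:P) fg subr0 exprDn_pchar //.
by rewrite addrC exprMn rmorphXn /= [_ * 'X^S]mulrC.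
Qed.

(* [f ^+ S] is constant modulo ['X^S], so modulo ['X^S] the square of the relation
   reads [r_0^2 = c f s_0^2], an exact equality for degree reasons. *)
Lemma digits_unique n (r s : 'I_n -> {poly E}) :
  (forall j, (size (r j) <= m)%N) -> (forall j, (size (s j) <= m)%N) ->
  \sum_j r j * 'X^(j * S) + f ^+ e * \sum_j s j * 'X^(j * S) = 0 ->
  forall j, r j = 0 /\ s j = 0.
Proof.
elim: n r s => [|n IH] r s sr ss; first by move=> _ [].
pose sh (r : 'I_n.+1 -> {poly E}) := \sum_(j < n) r (lift ord0 j) * 'X^(j * S).
have shE (t : 'I_n.+1 -> {poly E}) :
    \sum_j t j * 'X^(j * S) = t ord0 + 'X^S * sh t.
  rewrite big_ord_recl mul0n expr0 mulr1 mulr_sumr; congr (_ + _).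
  by apply: eq_bigr => j _; rewrite /= mulSn exprD mulrCA.
rewrite !shE => H0.
have [h fS] := expr_pchar_split.
set R := sh r in H0; set W := sh s in H0; set c := f.[0] ^+ S in fS.
have c0 : c != 0 by rewrite expf_neq0.
have e1 : r ord0 ^+ 2 - c *: (f * s ord0 ^+ 2) = 'X^S *
    (h * f * (s ord0 + 'X^S * W) ^+ 2 + c%:P * f * (s ord0 * W + s ord0 * W + 'X^S * W ^+ 2)
     - (r ord0 * R + r ord0 * R) - 'X^S * R ^+ 2).
  (* Isolate the part with [f ^+ e] and square it: [e + e = S.+1] gives
     [f ^+ (e + e) = f ^+ S * f]. *)
  have sq : (r ord0 + 'X^S * R) ^+ 2 = (c%:P + 'X^S * h) * f * (s ord0 + 'X^S * W) ^+ 2.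
    have -> : r ord0 + 'X^S * R = - (f ^+ e * (s ord0 + 'X^S * W)).
      by apply/eqP; rewrite -addr_eq0 H0.
    by rewrite sqrrN exprMn -exprM muln2 -addnn eS exprSr fS.
  rewrite -mul_polyC.
  have -> : r ord0 ^+ 2 = (r ord0 + 'X^S * R) ^+ 2
     - 'X^S * (r ord0 * R + r ord0 * R + 'X^S * R ^+ 2) by ring.
  by rewrite sq; ring.
(* A nonzero multiple of ['X^S] has size above [S], whereas [mS] bounds the sizes of both terms by
   [S]. *)
have e2 : r ord0 ^+ 2 - c *: (f * s ord0 ^+ 2) = 0.
  apply/eqP; apply: contraT => nz.
  have : 'X^S %| r ord0 ^+ 2 - c *: (f * s ord0 ^+ 2) by rewrite e1 dvdp_mulr.
  move/(dvdp_leq nz); rewrite size_polyXn ltnNge; case/negP.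
  apply: leq_trans (size_polyD _ _) _; rewrite size_polyN geq_max; apply/andP; split.
    rewrite expr2; have [->|r0] := eqVneq (r ord0) 0; first by rewrite mulr0 size_poly0.
    have m0 : (0 < m)%N by apply: leq_trans (sr ord0); rewrite lt0n size_poly_eq0.
    have sr0 : (size (r ord0) <= m.-1.+1)%N by rewrite prednK.
    by apply: leq_trans (size_mul_le sr0 sr0) _; lia.
  apply: leq_trans (size_scale_leq _ _) _.
  have [->|s0] := eqVneq (s ord0) 0; first by rewrite expr0n mulr0 size_poly0.
  have m0 : (0 < m)%N by apply: leq_trans (ss ord0); rewrite lt0n size_poly_eq0.
  have ss0 : (size (s ord0) <= m.-1.+1)%N by rewrite prednK.
  by rewrite expr2; apply: leq_trans (size_mul_le szf (size_mul_le ss0 ss0)) _; lia.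
have s00 : s ord0 = 0.
  by apply: (f_nsq c0 (r := r ord0)); apply/eqP; rewrite -subr_eq0 e2.
have r00 : r ord0 = 0.
  move/eqP: e2; rewrite s00 expr0n mulr0 scaler0 subr0 sqrf_eq0 => /eqP//.
have {}IH : forall j, r (lift ord0 j) = 0 /\ s (lift ord0 j) = 0.
  apply: (IH (fun j => r (lift ord0 j)) (fun j => s (lift ord0 j))) => //.
  have : 'X^S != 0 :> {poly E} by rewrite -size_poly_eq0 size_polyXn.
  move/mulfI; apply; rewrite mulr0 -[RHS]H0 s00 r00 !add0r mulrDr -/(sh r) -/(sh s) -/R -/W.
  by rewrite [in RHS]mulrCA.
by move=> j; case: (unliftP ord0 j) => [j' ->|->].
Qed.

(* Since [y^(S*S) = y] on E, [H.[y]^S] is the value at y of the linear combination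
   of the [T x], as soon as [f.[y]] is a nonsquare. That combination can be made 0
   with H <> 0, by [digits_unique]. *)
Lemma stepanov_bound n N B :
  ((m.-1) * S + n + e * D <= N)%N -> (N < 2 * m * n)%N ->
  (m + n.-1 * S + e * D <= B)%N ->
  (#|[set y | f.[y] ^+ (#|E|./2) == -1%R]| <= B)%N.
Proof.
move=> hN hI hB.
(* The boolean selects the factor 1 or [- f ^+ e]; the sign anticipates [f.[y] ^+ (e * S) = - f.[y]
   ^+ e] at nonsquare values. *)
pose I := (bool * ('I_m * 'I_n))%type.
pose T (i : I) : {poly E} :=
  (if i.1 then 1 else - f ^+ e) * 'X^(i.2.1 * S + i.2.2).
have fe : (size (f ^+ e) <= (e * D).+1)%N.
  elim: (e) => [|k IH]; first by rewrite expr0 size_poly1.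
  by rewrite exprS mulSn; apply: size_mul_le.
have sT x : (size (T x) <= N)%N.
  have X1 k : (size ('X^k : {poly E}) <= k.+1)%N by rewrite size_polyXn.
  have iS (i : 'I_m) : (i * S <= m.-1 * S)%N by rewrite leq_mul2r; have := ltn_ord i; lia.
  case: x => -[] [i j]; have := iS i; have := ltn_ord j; rewrite /T /= ?mul1r ?mulNr ?size_polyN.
    by move=> hj hi; apply: leq_trans (X1 _) _; lia.
  by move=> hj hi; apply: leq_trans (size_mul_le fe (X1 _)) _; lia.
have cI : (N < #|{: I}|)%N by rewrite !card_prod card_bool !card_ord mulnA.
have [u [i0 ui0] uT] := poly_linear_dependency sT cI.
(* The power [S] exchanges the exponents, from [i + j * S] to [i * S + j], and takes the
   coefficients [u ^+ S] back to [u]. *)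
pose co b (j : 'I_n) : {poly E} := \sum_(i < m) (u (b, (i, j)) ^+ S) *: 'X^i.
pose H := \sum_j co true j * 'X^(j * S) + f ^+ e * \sum_j co false j * 'X^(j * S).
have sco b j : (size (co b j) <= m)%N.
  apply: (leq_trans (size_sum _ _ _)); apply/bigmax_leqP => i _.
  by apply: leq_trans (size_scale_leq _ _) _; rewrite size_polyXn.
have coE b j (i : 'I_m) : (co b j)`_i = u (b, (i, j)) ^+ S.
  rewrite coef_sum (bigD1 i) //= coefZ coefXn eqxx mulr1 big1 ?addr0 // => k ki.
  by rewrite coefZ coefXn eq_sym (inj_eq val_inj) (negPf ki) mulr0.
have S0 : (0 < S)%N by case: (S) pS.
have Hn0 : H != 0.
  apply/eqP => H0; have := digits_unique (sco true) (sco false) H0 i0.2.2.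
  case=> h1 h2; case/eqP: ui0.
  have : u i0 ^+ S = 0.
    case: (i0) h1 h2 => -[] [i j] /= h1 h2; rewrite -coE ?h1 ?h2 coef0 //.
  by move/eqP; rewrite expf_eq0 S0 => /eqP.
have SS (x : E) : (x ^+ S) ^+ S = x by rewrite -exprM -cE expf_card.
have root_H y : f.[y] ^+ (#|E|./2) = -1 -> root H y.
  move=> fy; rewrite rootE; suff : H.[y] ^+ S == 0 by rewrite expf_eq0 S0.
  have coS b j : (co b j).[y] ^+ S = \sum_(i < m) u (b, (i, j)) * y ^+ (i * S).
    rewrite horner_sum expr_sum_pchar //; apply: eq_bigr => i _.
    by rewrite hornerZ hornerXn exprMn SS -exprM.
  have dig b : (\sum_j co b j * 'X^(j * S)).[y] ^+ S =
       \sum_j \sum_(i < m) u (b, (i, j)) * y ^+ (i * S + j).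
    rewrite horner_sum expr_sum_pchar //; apply: eq_bigr => j _.
    rewrite hornerM hornerXn exprMn coS mulr_suml; apply: eq_bigr => i _.
    by rewrite exprD mulrA; congr (_ * _); rewrite exprM SS.
  have feS : f.[y] ^+ (e * S) = - f.[y] ^+ e.
    have -> : (e * S = #|E|./2 + e)%N by rewrite cE; move: eS; nia.
    by rewrite exprD fy mulN1r.
  rewrite /H hornerD hornerM exprDn_pchar // exprMn !dig horner_exp -exprM feS.
  rewrite -[X in _ == X](horner0 y) -uT horner_sum.
  rewrite (eq_bigr (fun x : I =>
      (if x.1 then 1 else - f.[y] ^+ e) * (u (x.1, x.2) * y ^+ (x.2.1 * S + x.2.2)))); last first.
    move=> [b x] _; rewrite /T hornerZ hornerM hornerXn mulrCA.
    by case: b => /=; rewrite ?hornerN ?horner_exp ?hornerC.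
  rewrite -(pair_bigA _ (fun b x =>
      (if b then 1 else - f.[y] ^+ e) * (u (b, x) * y ^+ (x.1 * S + x.2)))) /=.
  rewrite big_bool /= -!mulr_sumr mul1r; apply/eqP.
  by congr (_ + _ * _); rewrite exchange_big pair_big; apply: eq_bigr => -[].
rewrite cardE; apply: leq_trans (_ : (size H).-1 <= _)%N.
  rewrite -ltnS prednK ?lt0n ?size_poly_eq0 //; apply: max_poly_roots => //.
    by apply/allP => y; rewrite mem_enum inE => /eqP; apply: root_H.
  exact: enum_uniq.
have m0 : (0 < m)%N by have := ltn_ord i0.2.1; lia.
have szd b : (size (\sum_j co b j * 'X^(j * S))%R <= (m.-1 + n.-1 * S).+1)%N.
  apply: (leq_trans (size_sum _ _ _)); apply/bigmax_leqP => j _.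
  have cj : (size (co b j) <= m.-1.+1)%N by rewrite prednK.
  have jS : (j * S <= n.-1 * S)%N by rewrite leq_mul2r; have := ltn_ord j; lia.
  have X1 : (size ('X^(j * S) : {poly E}) <= (n.-1 * S).+1)%N by rewrite size_polyXn.
  exact: size_mul_le cj X1.
rewrite -ltnS prednK ?lt0n ?size_poly_eq0 //.
apply: leq_trans (size_polyD _ _) _; rewrite geq_max; apply/andP; split.
  by apply: leq_trans (szd _) _; move: hB; lia.
by apply: leq_trans (size_mul_le fe (szd _)) _; move: hB; lia.
Qed.

End Stepanov.

(** Divide [r] and [s] by their gcd: then [s1 ^+ 2] divides [r1 ^+ 2] and is coprime to it, hence
    constant, so [f] is a constant times [r1 ^+ 2]. Thus [r1] divides [f] and its derivative, and
    [f] would be constant. *)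
Lemma separable_nonsquare (E : fieldType) (f : {poly E}) :
  coprimep f f^`() -> (1 < size f)%N ->
  forall (c : E) (r s : {poly E}),
    c != 0 -> r ^+ 2 = c *: (f * s ^+ 2) -> s = 0.
Proof.
move=> cop sf c r s c0 rs; apply/eqP; apply: contraT => s0.
set g := gcdp r s; have g0 : g != 0 by rewrite gcdp_eq0 (negPf s0) andbF.
have [r1 [s1 [rE sE cop1]]] : exists r1 s1, [/\ r = r1 * g, s = s1 * g & coprimep r1 s1].
  exists (r %/ g), (s %/ g); rewrite !divpK ?dvdp_gcdl ?dvdp_gcdr //; split=> //.
  by apply: coprimep_div_gcd; rewrite s0 orbT.
have e : r1 ^+ 2 = c *: (f * s1 ^+ 2).
  apply: (mulIf (expf_neq0 2 g0)); rewrite -exprMn -rE rs -scalerAl.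
  by rewrite sE exprMn mulrA.
have sz1 : size (s1 ^+ 2) = 1.
  apply/eqP; rewrite -coprimepp.
  apply: (@coprimep_dvdr _ (r1 ^+ 2)); first by rewrite e dvdpZr // dvdp_mull.
  by rewrite coprimep_expl // coprimep_expr // coprimep_sym.
have [k s1k] : exists k : E, s1 ^+ 2 = k%:P.
  by exists (s1 ^+ 2)`_0; apply: size1_polyC; rewrite sz1.
have k0 : k != 0 by rewrite -polyC_eq0 -s1k -size_poly_eq0 sz1.
have fE : f = (c * k)^-1 *: r1 ^+ 2.
  by rewrite e s1k [f * _]mulrC mul_polyC !scalerA -mulrA mulVf ?scale1r // mulf_neq0.
have : size r1 == 1.
  rewrite -coprimepp; apply: (@coprimep_dvdr _ f).
    by rewrite fE dvdpZr ?invr_eq0 ?mulf_neq0 // expr2 dvdp_mulr.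
  apply: (@coprimep_dvdl _ f^`()); last by [].
  rewrite fE derivZ dvdpZr ?invr_eq0 ?mulf_neq0 // expr2 derivM.
  by apply: dvdp_add; [apply: dvdp_mull | apply: dvdp_mulr].
move/size_poly1P => [k1 k10 r1k].
move: sf; rewrite fE r1k -mul_polyC -rmorphXn -rmorphM size_polyC.
by case: (_ == _).
Qed.

(** * Stepanov's bound on the Artin-Schreier curve *)

Section ArtinSchreierCurve.
Variables (E : finFieldType) (q S : nat) (c : E).
Hypotheses (two0 : (2 : E) != 0) (q1 : (1 < q)%N) (c0 : c != 0).
Hypotheses (pq : [pchar E].-nat q) (pS : [pchar E].-nat S).
Hypotheses (cE : #|E| = (S * S)%N) (qS : (4 * q < S)%N).

Definition as_poly : {poly E} := 'X^q - 'X.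
(** For [c = 4 * a * b] its value at [y] is the discriminant of [a * x ^+ 2 - u * x + b], where
    [u = y ^+ q - y]. *)
Definition disc_poly : {poly E} := as_poly ^+ 2 - c%:P.

Lemma size_as_poly : size as_poly = q.+1.
Proof. by rewrite /as_poly size_polyDl ?size_polyXn // size_polyN size_polyX. Qed.

Lemma size_disc_poly : size disc_poly = (2 * q).+1.
Proof.
have s2 : size (as_poly ^+ 2) = (2 * q).+1.
  have n0 : as_poly ^+ 2 != 0 by rewrite expf_neq0 // -size_poly_eq0 size_as_poly.
  have := size_exp as_poly 2; rewrite size_as_poly /= mulnC => <-.
  by rewrite prednK // lt0n size_poly_eq0.
rewrite /disc_poly size_polyDl // s2 size_polyN size_polyC c0 ltnS.
by rewrite (leq_trans (ltnW q1)) // leq_pmull.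
Qed.

Lemma deriv_as_poly : as_poly^`() = -1.
Proof.
rewrite /as_poly derivB derivXn derivX -mulr_natr.
suff -> : (q%:R : {poly E}) = 0 by rewrite mulr0 sub0r.
have pE : pdiv q \in [pchar E].
  by move/pnatP: pq; apply; rewrite ?pdiv_dvd ?pdiv_prime // ltnW.
have /eqP qE : (q%:R : E) == 0 by rewrite -(dvdn_pcharf pE) pdiv_dvd.
by rewrite -polyC_natr qE.
Qed.

(** As [as_poly] has derivative -1, [disc_poly] has derivative [- 2] times [as_poly], modulo which
    it is the nonzero constant [- c]. *)
Lemma coprime_disc_poly : coprimep disc_poly disc_poly^`().
Proof.
rewrite {2}/disc_poly derivB derivC subr0 expr2 derivM deriv_as_poly mulN1r mulrN1.
have -> : - as_poly - as_poly = (- 2) *: as_poly.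
  by rewrite scaleNr scaler_nat -opprD mulr2n.
rewrite coprimepZr ?oppr_eq0 // coprimep_sym /disc_poly expr2 coprimep_addl_mul.
by rewrite -rmorphN /= -alg_polyC coprimepZr ?oppr_eq0 // coprimep1.
Qed.

Lemma stepanov_disc :
  (2 * #|[set y | disc_poly.[y] ^+ (#|E|./2) == -1%R]| <= S * S + 6 * q * S)%N.
Proof.
have oS : odd S by have := card_odd_field two0; rewrite cE oddM andbb.
pose k := S./2; have Sk : (S = 2 * k + 1)%N by rewrite -[LHS]odd_double_half oS -/k; lia.
have [r kr] : exists r, (k = 2 * q + r)%N by exists (k - 2 * q)%N; lia.
have f0 : disc_poly.[0] != 0.
  rewrite /disc_poly /as_poly !hornerE expr0n; case: (q) q1 => //= _ _.
  by rewrite subrr expr0n sub0r oppr_eq0.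
have szf : (size disc_poly <= (2 * q).+1)%N by rewrite size_disc_poly.
have sz1 : (1 < size disc_poly)%N by rewrite size_disc_poly; lia.
have nsq := separable_nonsquare coprime_disc_poly sz1.
have e1 : (k.+1 + k.+1 = S.+1)%N by lia.
have m1 : ((k.+1 - q) + (k.+1 - q) + 2 * q <= S.+1)%N by lia.
(* The parameters are [e = k + 1], [D = 2 * q], [m = k + 1 - q], the largest that
   [m + m + D <= S + 1] allows, and [n = k + 2 * q], which keeps [2 * m * n] above [N] as soon as
   [k >= 2 * q]. *)
pose N := ((k.+1 - q).-1 * S + (k + 2 * q) + k.+1 * (2 * q))%N.
pose B := ((k.+1 - q) + (k + 2 * q).-1 * S + k.+1 * (2 * q))%N.
have NB : (N < 2 * (k.+1 - q) * (k + 2 * q))%N.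
  rewrite /N Sk kr.
  have -> : ((2 * q + r).+1 - q = q + r + 1)%N by lia.
  have -> : ((q + r + 1).-1 = q + r)%N by lia.
  by move: q1; clear; nia.
have := stepanov_bound pS cE f0 szf nsq e1 m1 (leqnn N) NB (leqnn B).
suff : (2 * B <= S * S + 6 * q * S)%N by move=> h1 h2; lia.
rewrite /B Sk kr.
have -> : ((2 * q + r).+1 - q = q + r + 1)%N by lia.
have -> : ((2 * q + r + 2 * q).-1 = 4 * q + r - 1)%N by lia.
have [t ->] : exists t, q = t.+1 by exists q.-1; rewrite prednK // ltnW.
have -> : (4 * t.+1 + r - 1 = 4 * t + r + 3)%N by lia.
by clear; nia.
Qed.
End ArtinSchreierCurve.

(** * The Weil bound for Kloosterman sums *)

Section KloostermanFamily.
Variables (F E : finFieldType) (iota : {rmorphism F -> E}) (chi : E -> algC) (S : nat).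
Hypotheses (two0 : (2 : E) != 0) (chiP : add_char chi).
Let q := #|F|.
Hypotheses (frob : forall y, chi (y ^+ q) = chi y).
Hypotheses (cE : #|E| = (S * S)%N) (pS : [pchar E].-nat S) (qS : (4 * q < S)%N).
Variables a b : F.
Hypotheses (a0 : a != 0) (b0 : b != 0).
Let v (x : E) := iota a * x + iota b / x.
Let f := disc_poly q (iota (4 * a * b)).
Let L (y : E) := y ^+ q - y.

(** If every [chi (iota c * u)] is 1, the sum is [q], at least the number of roots of
    [y ^+ q - y = u]. Otherwise the sum is 0, and the fibre is empty because [frob] makes [chi]
    trivial on [iota c * L y]. *)
Lemma card_fiber_le u :
  #|[set y | L y == u]|%:R <= \sum_(c : F) chi (iota c * u).
Proof.
have q1 : (1 < q)%N by apply: finNzRing_gt1.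
have [/forallP triv|] := boolP [forall c : F, chi (iota c * u) == 1].
  under eq_bigr do rewrite (eqP (triv _)).
  rewrite sumr_const ler_nat -/q.
  have sp : size (as_poly E q - u%:P) = q.+1.
    by rewrite size_polyDl size_as_poly // size_polyN ltnS (leq_trans (size_polyC_leq1 _)) // ltnW.
  have p0 : as_poly E q - u%:P != 0 by rewrite -size_poly_eq0 sp.
  rewrite cardE -ltnS -sp; apply: max_poly_roots p0 _ (enum_uniq _).
  apply/allP => y; rewrite mem_enum inE rootE /as_poly !hornerE /L => /eqP ->.
  by rewrite subrr.
rewrite negb_forall => /existsP[c0 hc].
have -> : \sum_(c : F) chi (iota c * u) = 0.
  apply/eqP; rewrite -(mulrI_eq0 _ (@mulfI _ (chi (iota c0 * u) - 1) _)) ?subr_eq0 //.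
  rewrite mulrBl mul1r subr_eq0 mulr_sumr; apply/eqP.
  rewrite [RHS](reindex_inj (addIr c0)); apply: eq_bigr => c _ /=.
  by rewrite rmorphD mulrDl add_charD // mulrC.
rewrite (_ : [set y | _] = set0) ?cards0 //; apply/setP => y; rewrite !inE.
apply: contraNF hc => /eqP <-; rewrite /L mulrBr add_charD // add_charN //.
have -> : iota c0 * y ^+ q = (iota c0 * y) ^+ q by rewrite exprMn -rmorphXn expf_card.
by rewrite frob -normCK norm_add_char // expr1n.
Qed.

(** The discriminant is a nonzero square [w ^+ 2], so [(u + w) / (2 * a)] and [(u - w) / (2 * a)]
    are distinct solutions, nonzero because [(u + w) * (u - w) = 4 * a * b]. *)
Lemma card_fiber_ge2 (y : E) : f.[y] ^+ (#|E|./2) = 1 ->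
  (2 <= \sum_(x | x != 0%R) (L y == v x))%N.
Proof.
have fy : f.[y] = L y ^+ 2 - iota (4 * a * b).
  by rewrite /f /disc_poly /as_poly !hornerE.
rewrite fy; set u := L y; set D := u ^+ 2 - _ => D1.
have D0 : D != 0.
  apply/eqP => D0; move/eqP: D1; rewrite D0 expr0n.
  have := finNzRing_gt1 E; rewrite (card_halfK two0).
  by case: (_./2) => //= n _; rewrite eq_sym oner_eq0.
have [w wD] := exp_half_square two0 D0 D1.
have ia0 : iota a != 0 by rewrite fmorph_eq0.
have ib0 : iota b != 0 by rewrite fmorph_eq0.
have four0 : (4 : E) != 0 by rewrite (_ : 4 = 2 * 2) ?mulf_neq0 //; ring.
have i4 : iota (4 * a * b) = 4 * iota a * iota b by rewrite !rmorphM rmorph_nat.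
have prod : (u + w) * (u - w) = 4 * iota a * iota b.
  by rewrite mulrC -subr_sqr -wD -i4 /D subKr.
have /andP[p0 m0] : (u + w != 0) && (u - w != 0).
  by rewrite -negb_or -mulf_eq0 prod !mulf_neq0.
have w0 : w != 0 by apply: contraNneq D0 => w0; rewrite wD w0 expr0n.
have sol z : z != 0 -> z * (u + u - z) = 4 * iota a * iota b ->
    (z / (2 * iota a) != 0) && (u == v (z / (2 * iota a))).
  move=> z0 hz; rewrite mulf_neq0 ?invr_eq0 ?mulf_neq0 //=; apply/eqP.
  have -> : u = (z + z * (u + u - z) / z) / 2 by field; rewrite z0 two0.
  by rewrite hz /v; field; rewrite z0 two0 ia0.
have /andP[x10 x1] : ((u + w) / (2 * iota a) != 0) && (u == v ((u + w) / (2 * iota a))).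
  by apply: sol => //; rewrite -prod; ring.
have /andP[x20 x2] : ((u - w) / (2 * iota a) != 0) && (u == v ((u - w) / (2 * iota a))).
  by apply: sol => //; rewrite -prod; ring.
rewrite (bigD1 ((u + w) / (2 * iota a))) //= x1.
rewrite (bigD1 ((u - w) / (2 * iota a))) /= ?x2 // x20 /=.
apply: contraNneq w0 => /(mulIf _) => e.
have : u - w = u + w by apply: e; rewrite invr_eq0 mulf_neq0.
move/addrI/eqP; rewrite eq_sym -subr_eq0 opprK -mulr2n -mulr_natl mulf_eq0.
by rewrite (negPf two0).
Qed.

(** Count the pairs [(x, y)] with [L y = v x] in two ways. Each [y] at which [f] is a nonzero square
    lies in two pairs; the other [y] are those of nonsquare value and at most [2 * q] roots of
    [f]. *)
Lemma kloosterman_family_ge :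
  (2 * (S * S - 2 * q - #|[set y | f.[y] ^+ (#|E|./2) == -1%R]|))%:R <=
  \sum_(c : F) kloosterman chi (iota (c * a)) (iota (c * b)).
Proof.
have -> : \sum_(c : F) kloosterman chi (iota (c * a)) (iota (c * b)) =
   \sum_(x | x != 0) \sum_(c : F) chi (iota c * v x).
  rewrite /kloosterman exchange_big; apply: eq_bigr => x x0; apply: eq_bigr => c _.
  by congr chi; rewrite /v !rmorphM; ring.
apply: le_trans (_ : \sum_(x | x != 0) #|[set y | L y == v x]|%:R <= _); last first.
  by apply: ler_sum => x _; apply: card_fiber_le.
rewrite -natr_sum ler_nat.
rewrite (eq_bigr (fun x => \sum_y (L y == v x)))%N; last first.
  by move=> x _; rewrite -sum1_card big_mkcond; apply: eq_bigr => y _; rewrite inE.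
rewrite exchange_big /=.
apply: leq_trans (_ : \sum_y (f.[y] ^+ (#|E|./2) == 1%R) * 2 <= _)%N; last first.
  by apply: leq_sum => y _; case: eqP => // /card_fiber_ge2; rewrite mul1n.
rewrite -big_distrl /= mulnC leq_mul2r /=.
have -> : (\sum_y (f.[y] ^+ (#|E|./2) == 1%R) = #|[set y | f.[y] ^+ (#|E|./2) == 1%R]|)%N.
  by rewrite -sum1_card [RHS]big_mkcond; apply: eq_bigr => y _; rewrite inE.
have c0 : iota (4 * a * b) != 0.
  rewrite fmorph_eq0 !mulf_neq0 // (_ : 4 = 2 * 2); last by ring.
  by rewrite mulf_neq0 // -(fmorph_eq0 iota) rmorph_nat.
have q1 : (1 < q)%N by apply: finNzRing_gt1.
have : (#|[set y | root f y]| <= 2 * q)%N.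
  have sf : size f = (2 * q).+1 := size_disc_poly q1 c0.
  have fn0 : f != 0 by rewrite -size_poly_eq0 sf.
  rewrite cardE -ltnS -sf; apply: max_poly_roots fn0 _ (enum_uniq _).
  by apply/allP => y; rewrite mem_enum inE.
set A := [set y | root f y]; set B := [set y | _ == -1]; set C := [set y | _ == 1].
have : (#|E| <= #|A| + #|B| + #|C|)%N.
  rewrite -cardsT; apply: leq_trans (_ : #|(A :|: B) :|: C| <= _)%N.
    apply: subset_leq_card; apply/subsetP => y _; rewrite !inE rootE.
    by have [//|fy] := eqVneq f.[y] 0; rewrite orbC; apply: exp_halfP.
  by rewrite -(leq_add2r #|(A :|: B) :&: C|) cardsUI; have := cardsUI A B; lia.
rewrite cE => h1 h2; rewrite -subnDA leq_subLR; apply: leq_trans h1 _.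
by rewrite !leq_add2r.
Qed.

Lemma kloosterman_family_lower :
  - (4 * q + 6 * q * S)%:R <= \sum_(c | c != 0) kloosterman chi (iota (c * a)) (iota (c * b)).
Proof.
have c0 : iota (4 * a * b) != 0.
  rewrite fmorph_eq0 !mulf_neq0 // (_ : 4 = 2 * 2); last by ring.
  by rewrite mulf_neq0 // -(fmorph_eq0 iota) rmorph_nat.
have q1 : (1 < q)%N by apply: finNzRing_gt1.
have pq : [pchar E].-nat q by rewrite (eq_pnat _ (fmorph_pchar iota)) pchar_nat_card.
have := stepanov_disc two0 q1 c0 pq pS cE qS; rewrite -/f.
have := kloosterman_family_ge; set n := #|_|.
rewrite (bigD1 0) //=.
(* The term [c = 0] accounts for the leading part of the bound, which is [S * S - 4 * q - 6 * q * S]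
   by [stepanov_disc]. *)
have -> : kloosterman chi (iota (0 * a)) (iota (0 * b)) = (S * S).-1%:R.
  rewrite /kloosterman; under eq_bigr do rewrite !mul0r rmorph0 !mul0r addr0 add_char0 //.
  by rewrite sumr_const -cE -(cardC1 (0 : E)); congr _%:R; apply: eq_card => x; rewrite !inE.
set X := \sum_(c | _) _ => h1 h2.
rewrite -(lerD2l (S * S).-1%:R); apply: le_trans h1.
rewrite lerBlDr -natrD ler_nat; nia.
Qed.

End KloostermanFamily.

(** * Growth along the tower against the lower bound *)

Lemma kloosterman_iter_real q K k : K \is Num.real -> kloosterman_iter q K k \is Num.real.
Proof.
move=> rK; elim: k => //= k IH.
by rewrite realB ?realX // realM ?realn.
Qed.

(** Let [x] be [- kloosterman_iter q K k.+1] over [q ^ 2 ^ k]. It starts at [2 + d] and follows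
    [x' = x ^+ 2 - 2], and [(2 + m * d) ^+ 2 - 2] is at least [2 + (m + 1) * d] for [m >= 1]. *)
Lemma kloosterman_iter_growth (q : nat) (K d : algC) (k : nat) :
  K \is Num.real -> 0 <= d -> K ^+ 2 = (4 + d) * q%:R ->
  (2 + k.+1%:R * d) * (q ^ 2 ^ k)%:R <= - kloosterman_iter q K k.+1.
Proof.
move=> rK d0 hK; elim: k => [|k IH].
  by rewrite /= hK mul1r expn1 opprB -subr_ge0 (_ : _ - _ = 0) //; ring.
rewrite [kloosterman_iter _ _ _]/= opprB -/(kloosterman_iter q K k.+1).
rewrite -[kloosterman_iter q K k.+1 ^+ 2]sqrrN.
set M := _ * (q ^ 2 ^ k)%:R in IH.
have M0 : 0 <= M by rewrite mulr_ge0 ?addr_ge0 ?mulr_ge0 ?ler0n.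
have : M ^+ 2 <= (- kloosterman_iter q K k.+1) ^+ 2.
  by rewrite lerXn2r ?nnegrE ?(le_trans M0).
move=> h; rewrite lerBrDr; apply: le_trans h.
rewrite -subr_ge0 /M exprMn -natrX -expnM -expnSr.
have -> : (2 + k.+1%:R * d) ^+ 2 * (q ^ 2 ^ k.+1)%:R -
   ((2 + k.+2%:R * d) * (q ^ 2 ^ k.+1)%:R + 2 * (q ^ 2 ^ k.+1)%:R) =
   ((3 * k%:R + 2) * d + (k.+1%:R * d) ^+ 2) * (q ^ 2 ^ k.+1)%:R.
  by rewrite -[k.+2]addn2 -[k.+1]addn1 !natrD; ring.
by rewrite mulr_ge0 ?ler0n // addr_ge0 ?exprn_ge0 ?mulr_ge0 ?addr_ge0 ?mulr_ge0 ?ler0n.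
Qed.

Lemma kloosterman_iter_lower (F : finFieldType) (psi : F -> algC) (a b : F) (j : nat) :
  (2 : F) != 0 -> add_char psi -> a != 0 -> b != 0 ->
  - (12 * #|F| * #|F| ^ 2 ^ j.+2)%:R <= kloosterman_iter #|F| (kloosterman psi a b) j.+3.
Proof.
move=> two0 psiP a0 b0; set q := #|F|; set S := (q ^ 2 ^ j.+2)%N.
have [E [iota [chi [cE chiP frob HK]]]] := kloosterman_tower j.+3 two0 psiP.
have two0E : (2 : E) != 0 by rewrite -(rmorph_nat iota) fmorph_eq0.
have cES : #|E| = (S * S)%N by rewrite cE /S mulnn -expnM -expnSr.
have pS : [pchar E].-nat S.
  by rewrite (eq_pnat _ (fmorph_pchar iota)) pnatX pchar_nat_card.
have q1 : (1 < q)%N := finNzRing_gt1 F.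
have q3 : (2 < q)%N.
  by rewrite ltn_neqAle q1 andbT; apply/eqP => q2; have := card_odd_field two0; rewrite -/q -q2.
(* Level [j.+3] is high enough for [S >= q ^ 4], and [q ^ 3 >= 27]. *)
have qS : (4 * q < S)%N.
  apply: leq_trans (_ : q ^ 4 <= S)%N; last first.
    by rewrite leq_exp2l // (_ : 4 = 2 ^ 2)%N // leq_exp2l.
  rewrite expnSr ltn_pmul2r ?(ltnW q1) //.
  by apply: leq_trans (_ : 3 ^ 3 <= _)%N => //; rewrite leq_exp2r.
(* At this level a sum is [2 * S] minus a real square. Bounding the terms [c != 1] in this way
   leaves a lower bound for the term [c = 1]. *)
have upper (c : F) : c != 0 ->
    kloosterman chi (iota (c * a)) (iota (c * b)) <= 2 * S%:R.
  move=> c0; rewrite HK ?mulf_neq0 // -/q /=.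
  rewrite gerBl; apply: real_exprn_even_ge0 => //.
  by apply: (kloosterman_iter_real q j.+2); apply: kloosterman_real.
have := kloosterman_family_lower iota two0E chiP frob cES pS qS a0 b0.
rewrite (bigD1 1) ?oner_neq0 //= !mul1r HK // -/q.
have le2 : \sum_(i | (i != 0) && (i != 1)) kloosterman chi (iota (i * a)) (iota (i * b))
     <= (q * (2 * S))%:R.
  apply: le_trans (_ : \sum_(i : F | (i != 0) && (i != 1)) 2 * S%:R <= _).
    by apply: ler_sum => c /andP[c0 _]; apply: upper.
  rewrite sumr_const -natrM -[_ *+ #|_|]mulr_natr -natrM ler_nat mulnC leq_mul2r; apply/orP; right.
  exact: max_card.
move/le_trans => /(_ _ (lerD (lexx _) le2)).
rewrite -lerBlDr; apply: le_trans.
rewrite -opprD -natrD lerN2 ler_nat; nia.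
Qed.

Theorem weil_kloosterman (F : finFieldType) (psi : F -> algC) (a b : F) :
  (2 : F) != 0 -> add_char psi -> a != 0 ->
  `|kloosterman psi a b| <= 2 * sqrtC #|F|%:R.
Proof.
move=> two0 psiP a0; set q := #|F|; set K := kloosterman psi a b.
have q0 : 0 < (q%:R : algC) by rewrite ltr0n; apply: ltnW; apply: finNzRing_gt1.
have rK : K \is Num.real by apply: kloosterman_real.
have nn : 0 <= 2 * sqrtC (q%:R : algC) by rewrite mulr_ge0 ?ler0n // sqrtC_ge0 ler0n.
have [bz|b0] := eqVneq b 0.
  rewrite /K bz /kloosterman; under eq_bigr do rewrite mul0r addr0.
  rewrite sum_neq0 sum_add_char // (negPf a0) mul0r mulr0 add_char0 // sub0r normrN normr1.
  have s1 : 1 <= sqrtC (q%:R : algC).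
    rewrite -[X in X <= _]sqrtC1 ler_sqrtC ?qualifE /= ?ler01 ?ler0n //.
    by rewrite ler1n; apply: ltnW; apply: finNzRing_gt1.
  by rewrite -[X in X <= _](mulr1 1) ler_pM ?ler01 ?ler1n.
rewrite real_leNgt ?normr_real ?ger0_real //; apply/negP => lt.
have : (2 * sqrtC q%:R) ^+ 2 < K ^+ 2.
  by rewrite -[K ^+ 2]real_normK // ltrXn2r // nnegrE.
rewrite exprMn sqrtCK -natrX -subr_gt0 => dq.
set d := (K ^+ 2 - 4 * q%:R) / q%:R.
have d0 : 0 < d by rewrite divr_gt0.
have hK : K ^+ 2 = (4 + d) * q%:R by rewrite mulrDl divfK ?gt_eqF //; ring.
(* After division by [S], the growth is linear in [j] while the lower bound is independent of [j];
   for [d > 0] the archimedean property refutes this. *)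
have bound j : (2 + j.+3%:R * d) <= (12 * q)%:R.
  have := kloosterman_iter_growth j.+2 rK (ltW d0) hK.
  have := kloosterman_iter_lower j two0 psiP a0 b0.
  rewrite -/q -/K lerNl natrM => h1 h2; have := le_trans h2 h1.
  by rewrite ler_pM2r // ltr0n expn_gt0 -(ltr0n algC) q0.
have [n hn] : exists n : nat, (12 * q)%:R / d < n%:R.
  exists (Num.bound ((12 * q)%:R / d)); apply: archi_boundP.
  by rewrite divr_ge0 ?ler0n // ltW.
have := bound n; apply/negP; rewrite -real_ltNge ?realn //; last first.
  by rewrite realD ?realn // realM ?realn // gtr0_real.
apply: lt_le_trans (_ : n%:R * d <= _); first by rewrite -ltr_pdivrMr.
rewrite -[X in X <= _]add0r lerD ?ler0n // ler_pM2r // ler_nat; lia.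
Qed.

(** * Fourier transform of the sphere *)

Definition dot (F : finFieldType) (d : nat) (xi x : 'rV[F]_d) : F :=
  \sum_j xi ord0 j * x ord0 j.

Lemma sum_prod_rV (F : finFieldType) (d : nat) (G : 'I_d -> F -> algC) :
  \sum_(x : 'rV[F]_d) \prod_j G j (x ord0 j) = \prod_j \sum_t G j t.
Proof.
rewrite bigA_distr_bigA (reindex (fun g : {ffun 'I_d -> F} => \row_j g j)) /=.
  by apply: eq_bigr => g _; apply: eq_bigr => j _; rewrite mxE.
exists (fun x : 'rV[F]_d => [ffun j => x ord0 j]) => [g|x] _.
  by apply/ffunP => j; rewrite ffunE mxE.
by apply/rowP => j; rewrite mxE ffunE.
Qed.

Section SphereFourier.
Variables (F : finFieldType) (d : nat) (psi : F -> algC).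
Hypotheses (two0 : (2 : F) != 0) (psiP : add_char psi).
Let q : algC := #|F|%:R.
Notation V := 'rV[F]_d.
Implicit Types (x xi : V).

Lemma dotBr xi x y : dot xi (x - y) = dot xi x - dot xi y.
Proof. by rewrite /dot -sumrB; apply: eq_bigr => j _; rewrite !mxE mulrBr. Qed.

Lemma sum_add_char_dot x : \sum_xi psi (dot xi x) = (x == 0)%:R * q ^+ d.
Proof.
under eq_bigr do rewrite /dot add_char_sum //.
rewrite (sum_prod_rV (fun j t => psi (t * x ord0 j))).
under eq_bigr do under eq_bigr do rewrite mulrC.
under eq_bigr do rewrite sum_add_char //.
rewrite big_split /= prodr_const card_ord; congr (_ * _).
have [->|x0] := eqVneq x 0; first by rewrite big1 // => j _; rewrite mxE eqxx.
have [j xj] : exists j, x ord0 j != 0.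
  apply/existsP; apply: contraNT x0; rewrite negb_exists => /forallP h.
  by apply/eqP/rowP => j; rewrite mxE; apply/eqP; have := h j; rewrite negbK.
by rewrite (bigD1 j) //= (negPf xj) mul0r.
Qed.

(** Orthogonality writes [sigma lam x] as the sum over all [s]; subtracting 1 removes [s = 0]. *)
Lemma sigma_subr1 lam x :
  sigma lam x - 1 = \sum_(s | s != 0) psi (s * (sqnorm x - lam)).
Proof.
rewrite sum_neq0 mul0r add_char0 //; congr (_ - _).
under eq_bigr do rewrite mulrC.
rewrite sum_add_char // subr_eq0 /sigma; case: ifP => _; rewrite ?mul1r ?mul0r //.
Qed.

Definition fourier (g : V -> algC) xi := \sum_x g x * psi (dot xi x).

(** For fixed [s] the sum over [x] factors into [d] quadratic sums in one variable, each
    contributing [eta s * gauss psi]. *)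
Lemma fourier_sphere lam xi : fourier (fun x => sigma lam x - 1) xi =
  gauss psi ^+ d * \sum_(s | s != 0) eta s ^+ d * psi (- lam * s + - (sqnorm xi / 4) / s).
Proof.
have f0 : (4 : F) != 0 by rewrite (_ : 4 = 2 * 2) ?mulf_neq0 //; ring.
rewrite /fourier; under eq_bigr do rewrite sigma_subr1 mulr_suml.
rewrite exchange_big mulr_sumr /=; apply: eq_bigr => s s0.
transitivity (psi (- lam * s) * \sum_(x : V) \prod_j psi (s * x ord0 j ^+ 2 + xi ord0 j * x ord0 j)).
  rewrite mulr_sumr; apply: eq_bigr => x _; rewrite -add_char_sum // big_split /=.
  rewrite -mulr_sumr -/(sqnorm x) -/(dot xi x) -!add_charD //; congr psi; ring.
rewrite (sum_prod_rV (fun j t => psi (s * t ^+ 2 + xi ord0 j * t))).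
under eq_bigr do rewrite sum_add_char_quadratic //.
rewrite big_split /= prodr_const card_ord exprMn -add_char_sum // add_charD //.
rewrite (_ : \sum_i _ = - (sqnorm xi / 4) / s); first by ring.
rewrite sumrN /sqnorm mulNr !mulr_suml; congr (- _); apply: eq_bigr => j _.
by field; rewrite s0 f0.
Qed.

(** The Gauss sums give [sqrtC q ^+ d], and the Salié or Kloosterman sum one more factor
    [2 * sqrtC q]. As its first parameter is [- lam], the bound also holds at [xi = 0]. *)
Lemma norm_fourier_sphere lam xi : lam != 0 ->
  `|fourier (fun x => sigma lam x - 1) xi| <= 2 * sqrtC q ^+ d.+1.
Proof.
move=> lam0; rewrite fourier_sphere normrM normrX.
have -> : `|gauss psi| = sqrtC q.
  apply/(@pexpIrn _ 2); rewrite ?nnegrE ?normr_ge0 ?sqrtC_ge0 ?ler0n //.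
  by rewrite norm_gauss // sqrtCK.
rewrite exprSr mulrCA ler_wpM2l ?exprn_ge0 ?sqrtC_ge0 ?ler0n //.
have nl0 : - lam != 0 by rewrite oppr_eq0.
have odd2 s : s != 0 -> eta s ^+ d = if odd d then eta s else 1.
  move=> s0; rewrite -[d in LHS]odd_double_half exprD -mul2n exprM expr2 eta_sqr // expr1n mulr1.
  by case: odd.
under eq_bigr => s s0 do rewrite odd2 //.
case: (odd d); first exact: norm_salie_le.
under eq_bigr do rewrite mul1r.
exact: weil_kloosterman.
Qed.

Lemma fourier_inversion g x :
  \sum_xi fourier g xi * psi (- dot xi x) = q ^+ d * g x.
Proof.
transitivity (\sum_y g y * \sum_xi psi (dot xi (y - x))).
  under eq_bigr do rewrite /fourier mulr_suml.
  rewrite exchange_big; apply: eq_bigr => y _; rewrite mulr_sumr; apply: eq_bigr => xi _.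
  by rewrite dotBr add_charD // mulrA.
rewrite (bigD1 x) //= [X in _ + X]big1 ?addr0 => [|y yx].
  by rewrite sum_add_char_dot subrr eqxx mul1r mulrC.
by rewrite sum_add_char_dot subr_eq0 (negPf yx) mul0r mulr0.
Qed.

Lemma parseval g : \sum_xi `|fourier g xi| ^+ 2 = q ^+ d * \sum_x `|g x| ^+ 2.
Proof.
transitivity (\sum_xi \sum_y (g y)^* * (fourier g xi * psi (- dot xi y))).
  apply: eq_bigr => xi _; rewrite normCK {2}/fourier rmorph_sum mulr_sumr.
  by apply: eq_bigr => y _; rewrite rmorphM /= add_charN //= mulrCA.
rewrite exchange_big mulr_sumr; apply: eq_bigr => y _.
by rewrite -mulr_sumr fourier_inversion normCK mulrCA [_^* * _]mulrC.
Qed.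

(** The Fourier transform diagonalises the form. The factor 2 of [norm_fourier_sphere] is absorbed
    by [2 * x * y <= x ^+ 2 + y ^+ 2], and Parseval returns to [g] and [h]. *)
Lemma bilinear_sphere_bound lam (g h : V -> algC) : lam != 0 ->
  `|\sum_u \sum_v g u * h v * (sigma lam (u - v) - 1)| <=
  sqrtC q ^+ d.+1 * (\sum_u `|g u| ^+ 2 + \sum_v `|h v| ^+ 2).
Proof.
move=> lam0; pose kap x := sigma lam x - 1.
set B := \sum_u _; pose g' u := (g u)^*.
have q0 : 0 < q ^+ d by rewrite exprn_gt0 // ltr0n; apply: ltnW; apply: finNzRing_gt1.
have eB : q ^+ d * B = \sum_xi fourier kap xi * ((fourier g' xi)^* * fourier h xi).
  transitivity (\sum_u \sum_v g u * h v * \sum_xi fourier kap xi * psi (- dot xi (u - v))).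
    rewrite mulr_sumr; apply: eq_bigr => u _; rewrite mulr_sumr; apply: eq_bigr => v _.
    by rewrite fourier_inversion mulrCA.
  transitivity (\sum_xi \sum_u \sum_v g u * h v * (fourier kap xi * psi (- dot xi (u - v)))).
    rewrite [RHS]exchange_big; apply: eq_bigr => u _; rewrite [RHS]exchange_big.
    by apply: eq_bigr => v _; rewrite mulr_sumr.
  apply: eq_bigr => xi _; move: (fourier kap xi) => K.
  rewrite /fourier rmorph_sum mulr_suml mulr_sumr.
  apply: eq_bigr => u _; rewrite /= 2!mulr_sumr; apply: eq_bigr => v _.
  rewrite rmorphM /= /g' conjCK -add_charN // dotBr opprB addrC add_charD //; ring.
rewrite -(ler_pM2l q0) -{1}(gtr0_norm q0) -normrM eB.
apply: le_trans (ler_norm_sum _ _ _) _.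
apply: le_trans (_ : \sum_xi sqrtC q ^+ d.+1 * (`|fourier g' xi| ^+ 2 + `|fourier h xi| ^+ 2) <= _).
  apply: ler_sum => xi _; rewrite !normrM norm_conjC.
  apply: le_trans (ler_wpM2r _ (norm_fourier_sphere xi lam0)) _; first by rewrite mulr_ge0.
  rewrite [2 * _]mulrC -mulrA ler_wpM2l ?exprn_ge0 ?sqrtC_ge0 ?ler0n //.
  rewrite -subr_ge0; set x := `|_|; set y := `|_|.
  have -> : x ^+ 2 + y ^+ 2 - 2 * (x * y) = (x - y) ^+ 2 by ring.
  by apply: real_exprn_even_ge0 => //; rewrite realB // normr_real.
rewrite -mulr_sumr big_split /= !parseval mulrCA -mulrDr.
by under [X in X + _]eq_bigr do rewrite norm_conjC.
Qed.

End SphereFourier.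

(** * Counting weighted configurations *)

Definition touch (n : nat) (k : 'I_n) (e : 'I_n * 'I_n) := (e.1 == k) || (e.2 == k).

Definition update (n : nat) (V : Type) (x : {ffun 'I_n -> V}) (i : 'I_n) (u : V) :
  {ffun 'I_n -> V} := [ffun k => if k == i then u else x k].

(** Exchanging [u] with the coordinate [x i] is an involution on pairs [(x, u)]. *)
Lemma sum_update (n : nat) (V : finType) (i : 'I_n) (Phi : {ffun 'I_n -> V} -> algC) :
  \sum_x \sum_u Phi (update x i u) = #|V|%:R * \sum_x Phi x.
Proof.
pose sw (p : {ffun 'I_n -> V} * V) := (update p.1 i p.2, p.1 i).
have swK : involutive sw.
  case=> x u; rewrite /sw /= ffunE eqxx; congr pair.
  by apply/ffunP => k; rewrite !ffunE; case: eqP => [->|].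
rewrite pair_big (reindex_inj (inv_inj swK)) /=.
rewrite (eq_bigr (fun p => Phi p.1)); last first.
  move=> [x u] _ /=; congr Phi; apply/ffunP => k; rewrite !ffunE.
  by case: eqP => [->|].
rewrite -(pair_bigA _ (fun x _ => Phi x)) /= mulr_sumr.
by apply: eq_bigr => x _; rewrite sumr_const mulr_natl.
Qed.

Section Counting.
Variables (F : finFieldType) (d n : nat) (len : 'I_n -> 'I_n -> F) (A : {set 'rV[F]_d}).
Let q : algC := #|F|%:R.
Implicit Types (W : {set 'I_n}) (E : {set 'I_n * 'I_n}).
Notation V := 'rV[F]_d.
Notation conf := {ffun 'I_n -> V}.
Notation edge := ('I_n * 'I_n)%type.

Definition vertex_weight (W : {set 'I_n}) (x : conf) : algC :=
  \prod_(k in W) (x k \in A)%:R.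
Definition edge_weight (E : {set edge}) (x : conf) : algC :=
  \prod_(e in E) sigma (len e.1 e.2) (x e.1 - x e.2).
(** The average always runs over all [n] coordinates, so that deleting a vertex only shrinks [W]: a
    coordinate outside [W] and off all edges averages to 1. *)
Definition weighted_count (E : {set edge}) (W : {set 'I_n}) : algC :=
  q ^- (d * n) * \sum_x vertex_weight W x * edge_weight E x.

Lemma card_field_gt0 : 0 < q.
Proof. by rewrite ltr0n; apply: ltnW; apply: finNzRing_gt1. Qed.

Lemma vertex_weight_eq (W : {set 'I_n}) (x y : conf) : {in W, x =1 y} -> vertex_weight W x = vertex_weight W y.
Proof. by move=> h; apply: eq_bigr => k /h ->. Qed.

Lemma edge_weight_eq (E : {set edge}) (x y : conf) :
  (forall e, e \in E -> x e.1 = y e.1 /\ x e.2 = y e.2) ->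
  edge_weight E x = edge_weight E y.
Proof. by move=> h; apply: eq_bigr => e /h [-> ->]. Qed.

Lemma edge_weight_split (T : pred edge) E x : edge_weight E x =
  edge_weight [set e in E | T e] x * edge_weight [set e in E | ~~ T e] x.
Proof.
rewrite /edge_weight (bigID T) /=.
by congr (_ * _); apply: eq_bigl => e; rewrite inE.
Qed.

Lemma vertex_weightD1 W (k : 'I_n) (x : conf) : k \in W ->
  vertex_weight W x = (x k \in A)%:R * vertex_weight (W :\ k) x.
Proof.
move=> kW; rewrite /vertex_weight (bigD1 k) //=; congr (_ * _).
by apply: eq_bigl => l; rewrite !inE andbC.
Qed.

Lemma edge_weight_bounds E x : 0 <= edge_weight E x <= q ^+ #|E|.
Proof.
rewrite /edge_weight prodr_ge0 => [|e _]; last by rewrite /sigma; case: ifP => _ //; apply: ltW card_field_gt0.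
rewrite -prodr_const; apply: ler_prod => e _; rewrite /sigma; case: ifP => _.
  by rewrite lexx ltW ?card_field_gt0.
by rewrite lexx ltW ?card_field_gt0.
Qed.

Lemma weighted_count_ge0 E W : 0 <= weighted_count E W.
Proof.
rewrite mulr_ge0 ?invr_ge0 ?exprn_ge0 ?(ltW card_field_gt0) //; apply: sumr_ge0 => x _.
rewrite mulr_ge0 ?(andP (edge_weight_bounds _ _)).1 //.
by apply: prodr_ge0 => k _; apply: ler0n.
Qed.

Lemma card_space : #|{: V}|%:R = q ^+ d.
Proof. by rewrite card_mx mul1n natrX. Qed.

Lemma weighted_count_no_edge W : weighted_count set0 W = (#|A|%:R / q ^+ d) ^+ #|W|.
Proof.
have qn0 : q != 0 by rewrite gt_eqF ?card_field_gt0.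
rewrite /weighted_count; under eq_bigr do rewrite /edge_weight big_set0 mulr1 /vertex_weight big_mkcond.
rewrite -(bigA_distr_bigA (fun k u => if k \in W then (u \in A)%:R else 1)) /=.
have -> : q ^- (d * n) = \prod_(i < n) q ^- d by rewrite prodr_const card_ord exprVn exprM.
rewrite -big_split /=.
rewrite -prodr_const [RHS]big_mkcond; apply: eq_bigr => k _.
case: ifP => _.
  rewrite mulrC; congr (_ / _).
  by rewrite -natr_sum -sum1_card [in RHS]big_mkcond; congr _%:R; apply: eq_bigr => u _; case: ifP.
by rewrite sumr_const card_space mulVf // expf_neq0.
Qed.

Lemma edge_removal_error (psi : F -> algC) (i j : 'I_n) E W (s : nat) :
  (2 : F) != 0 -> add_char psi -> i != j -> i \in W -> j \in W -> len i j != 0 ->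
  (forall f, f \in E -> ~~ (touch i f && touch j f)) ->
  (#|[set f in E | touch i f]| <= s)%N -> (#|[set f in E | touch j f]| <= s)%N ->
  `|weighted_count ((i, j) |: E) W - weighted_count E W| <= sqrtC q ^+ d.+1 * q ^+ s / q ^+ d *
    (weighted_count [set f in E | ~~ touch j f] (W :\ j) + weighted_count [set f in E | ~~ touch i f] (W :\ i)).
Proof.
move=> two0 psiP ij iW jW lam0 sep degi degj.
have ji : j != i by rewrite eq_sym.
set Ni := [set f in E | ~~ touch j f]; set Nj := [set f in E | ~~ touch i f].
pose Ei := [set f in E | touch i f]; pose Ej := [set f in E | touch j f].
pose E0 := [set f in Ni | ~~ touch i f]; pose W0 := W :\ i :\ j.
pose P x := vertex_weight W0 x * edge_weight E0 x.
pose gi (x : conf) := (x i \in A)%:R * edge_weight Ei x.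
pose gj (x : conf) := (x j \in A)%:R * edge_weight Ej x.
(* [P] involves neither [x i] nor [x j], and by [sep] [gi] does not involve [x j]; [P * gi] is the
   weight after deletion of [j]. *)
have NiE x : vertex_weight (W :\ j) x * edge_weight Ni x = P x * gi x.
  rewrite (vertex_weightD1 (k := i)) ?inE ?ij // (edge_weight_split (touch i)) -/E0.
  have -> : W :\ j :\ i = W0 by rewrite /W0 !setDDl setUC.
  have -> : [set f in Ni | touch i f] = Ei.
    apply/setP => f; rewrite !inE; case fE: (f \in E) => //=.
    by have := sep f fE; case: (touch i f); case: (touch j f).
  by rewrite /P /gi; ring.
have NjE x : vertex_weight (W :\ i) x * edge_weight Nj x = P x * gj x.
  rewrite (vertex_weightD1 (k := j)) ?inE ?ji // (edge_weight_split (touch j)) -/W0.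
  have -> : [set f in Nj | ~~ touch j f] = E0.
    by apply/setP => f; rewrite !inE -!andbA [~~ touch i f && _]andbC.
  have -> : [set f in Nj | touch j f] = Ej.
    apply/setP => f; rewrite !inE; case fE: (f \in E) => //=.
    by have := sep f fE; case: (touch i f); case: (touch j f).
  by rewrite /P /gj; ring.
have EE x : vertex_weight W x * edge_weight E x = P x * gi x * gj x.
  rewrite (vertex_weightD1 x jW) (edge_weight_split (touch j)) -/Ej -/Ni.
  by rewrite -NiE /gj; ring.
pose kap (u : V) := sigma (len i j) u - 1.
have q0 := card_field_gt0; have qd0 : 0 < q ^+ d by rewrite exprn_gt0.
pose Phi (x : conf) := P x * gi x * gj x * kap (x i - x j).
have diff : weighted_count ((i, j) |: E) W - weighted_count E W = q ^- (d * n) * \sum_x Phi x.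
  rewrite /weighted_count -mulrBr -sumrB; congr (_ * _); apply: eq_bigr => x _.
  rewrite /edge_weight big_setU1 /=; last first.
    by apply/negP => /sep; rewrite /touch /= !eqxx orbT.
  rewrite -/(edge_weight E x) mulrCA EE /Phi /kap; ring.
have PU k x u : (k == i) || (k == j) -> P (update x k u) = P x.
  move=> kij; congr (_ * _).
    apply: vertex_weight_eq => l; rewrite !inE ffunE => /and3P[lj li _].
    by case: eqP => // lk; move: kij; rewrite -lk (negPf lj) (negPf li).
  apply: edge_weight_eq => f; rewrite !inE /touch !negb_or.
  case/andP=> /andP[_ /andP[k1 k2]] /andP[k3 k4]; rewrite !ffunE.
  by case/orP: kij => /eqP ->; rewrite ?(negPf k1) ?(negPf k2) ?(negPf k3) ?(negPf k4).
(* Resampling the coordinates [i] and [j] exposes, for each frozen [x], a bilinear form with kernel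
   [kap]. *)
have Phi_upd : q ^+ d * (q ^+ d * \sum_x Phi x) =
    \sum_x P x * \sum_u \sum_v gi (update x i u) * gj (update x j v) * kap (u - v).
  rewrite -card_space -(sum_update j) -(sum_update i); apply: eq_bigr => x _.
  rewrite mulr_sumr; apply: eq_bigr => u _; rewrite mulr_sumr; apply: eq_bigr => v _.
  set y := update _ j v.
  have yi : y i = u by rewrite !ffunE (negPf ij) eqxx.
  have yj : y j = v by rewrite !ffunE eqxx.
  have Py : P y = P x by rewrite /y !PU ?eqxx ?orbT.
  have giy : gi y = gi (update x i u).
    rewrite /gi yi [update x i u i]ffunE eqxx; congr (_ * _).
    apply: edge_weight_eq => f; rewrite inE => /andP[/sep h ti].
    move: h; rewrite ti /= /touch negb_or => /andP[n1 n2].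
    by rewrite ![update _ j _ _]ffunE (negPf n1) (negPf n2).
  have gjy : gj y = gj (update x j v).
    rewrite /gj yj [update x j v j]ffunE eqxx; congr (_ * _).
    apply: edge_weight_eq => f; rewrite inE => /andP[/sep h tj].
    move: h; rewrite tj andbT /= /touch negb_or => /andP[n1 n2].
    by rewrite !ffunE (negPf n1) (negPf n2).
  by rewrite /Phi yi yj Py giy gjy -2![P x * _ * _]mulrA.
have P0 x : 0 <= P x.
  rewrite mulr_ge0 ?(andP (edge_weight_bounds _ _)).1 //.
  by apply: prodr_ge0 => k _; apply: ler0n.
have gb E1 (b : bool) x : (#|E1| <= s)%N -> 0 <= b%:R * edge_weight E1 x <= q ^+ s.
  move=> h; have /andP[e0 e1] := edge_weight_bounds E1 x.
  have eqs : edge_weight E1 x <= q ^+ s.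
    apply: le_trans e1 _; rewrite /q -!natrX ler_nat leq_pexp2l //.
    by apply: ltnW; apply: finNzRing_gt1.
  by case: b; rewrite ?mul1r ?e0 ?mul0r ?lexx //= (le_trans e0).
(* The squares in [bilinear_sphere_bound] become first powers at the cost of [q ^+ s], so that
   counts reappear. *)
have sqg (G : conf -> algC) y : 0 <= G y <= q ^+ s -> `|G y| ^+ 2 <= q ^+ s * G y.
  by move=> /andP[h1 h2]; rewrite ger0_norm // expr2 ler_wpM2r.
have bound x : `|P x * \sum_u \sum_v gi (update x i u) * gj (update x j v) * kap (u - v)|
   <= sqrtC q ^+ d.+1 * q ^+ s *
      (\sum_u (P x * gi (update x i u)) + \sum_v (P x * gj (update x j v))).
  rewrite normrM ger0_norm // -!mulr_sumr -mulrDr mulrCA ler_wpM2l //.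
  have := @bilinear_sphere_bound F d psi two0 psiP (len i j)
            (fun u => gi (update x i u)) (fun v => gj (update x j v)) lam0.
  move/le_trans; apply; rewrite -mulrA ler_wpM2l ?exprn_ge0 ?sqrtC_ge0 ?(ltW q0) //.
  rewrite mulrDr lerD // mulr_sumr; apply: ler_sum => u _; apply: sqg; exact: gb.
have sumP (k : 'I_n) (G : conf -> algC) : (k == i) || (k == j) ->
    \sum_x \sum_u P x * G (update x k u) = q ^+ d * \sum_x P x * G x.
  move=> kij; rewrite -card_space -(sum_update k); apply: eq_bigr => x _.
  by apply: eq_bigr => u _; rewrite PU.
rewrite diff normrM ger0_norm ?invr_ge0 ?exprn_ge0 ?(ltW q0) //.
rewrite /weighted_count -mulrDr mulrCA ler_wpM2l ?invr_ge0 ?exprn_ge0 ?(ltW q0) //.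
rewrite -(ler_pM2l qd0) -(ler_pM2l qd0) -{1 2}(gtr0_norm qd0) -!normrM Phi_upd.
apply: le_trans (ler_norm_sum _ _ _) _; apply: le_trans (ler_sum _ (fun x _ => bound x)) _.
rewrite -mulr_sumr big_split /= !sumP ?eqxx ?orbT // -mulrDr.
under [X in _ <= _ * (_ * (_ * (X + _)))]eq_bigr do rewrite NiE.
under [X in _ <= _ * (_ * (_ * (_ + X)))]eq_bigr do rewrite NjE.
rewrite le_eqVlt; apply/orP; left; apply/eqP.
by field; rewrite gt_eqF.
Qed.

End Counting.

(** * Induction on the number of edges *)

Section CountingError.
Variables (F : finFieldType) (d n : nat) (len : 'I_n -> 'I_n -> F) (A : {set 'rV[F]_d}).
Variables (alpha : algC) (G : {set 'I_n * 'I_n}) (t : nat).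
Let q : algC := #|F|%:R.
Let theta : algC := q ^+ t / sqrtC q ^+ d.+1.
Hypothesis two0 : (2 : F) != 0.
Hypothesis ordG : forall f, f \in G -> (f.1 < f.2)%N.
Hypothesis lenG : forall f, f \in G -> len f.1 f.2 != 0.
Hypothesis degG : forall i, (#|[set f in G | touch i f]| <= t)%N.
Hypothesis cardA : #|A|%:R = alpha * q ^+ d.
Hypothesis alpha_large : 4 * #|G|%:R * theta <= alpha.

Lemma weighted_count_error (k : nat) (E : {set 'I_n * 'I_n}) (W : {set 'I_n}) :
  (#|E| <= k)%N -> E \subset G ->
  (forall f, f \in E -> (f.1 \in W) && (f.2 \in W)) ->
  `|weighted_count len A E W - alpha ^+ #|W| | <= 4 * #|E|%:R * alpha ^+ #|W|.-1 * theta.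
Proof.
have q0 : 0 < q by rewrite ltr0n; apply: ltnW; apply: finNzRing_gt1.
have sq0 : 0 < sqrtC q by rewrite sqrtC_gt0.
have theta0 : 0 <= theta by rewrite divr_ge0 ?exprn_ge0 ?ltW.
have alpha0 : 0 <= alpha.
  apply: le_trans alpha_large.
  by apply: mulr_ge0 => //; apply: mulr_ge0; apply: ler0n.
elim: k E W => [|k IH] E W cE EG EW.
  move: cE; rewrite leqn0 cards_eq0 => /eqP ->.
  by rewrite weighted_count_no_edge cardA mulfK ?expf_neq0 ?gt_eqF // subrr normr0 cards0 mulr0 !mul0r.
have [->|[[i j] eE]] := set_0Vmem E.
  by rewrite weighted_count_no_edge cardA mulfK ?expf_neq0 ?gt_eqF // subrr normr0 cards0 mulr0 !mul0r.
have /andP[/= iW jW] := EW _ eE.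
have eG : (i, j) \in G := subsetP EG _ eE.
have ltij : (i < j)%N := ordG eG.
have ij : i != j by rewrite -val_eqE neq_ltn ltij.
set E' := E :\ (i, j).
have EE' : E = (i, j) |: E' by rewrite setD1K.
have cE' : #|E| = #|E'|.+1 by rewrite (cardsD1 (i, j)) eE.
have sub' : E' \subset G by apply: subset_trans EG; apply: subD1set.
have EW' f : f \in E' -> (f.1 \in W) && (f.2 \in W).
  by rewrite !inE => /andP[_ /EW].
(* Edges are increasing pairs, so no second pair joins [i] and [j]. *)
have sep f : f \in E' -> ~~ (touch i f && touch j f).
  move=> fE'; have := ordG (subsetP sub' _ fE'); move: fE'; case: f => a b.
  rewrite !inE /touch /= => /andP[ne _] ltab; apply/negP => /andP[].
  case/orP=> /eqP e1; case/orP=> /eqP e2; move: ne ltab; rewrite ?e1 ?e2 ?eqxx //.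
  - by move: ij; rewrite -e1 -e2 eqxx.
  - by rewrite ltnNge ltnW.
  - by move: ij; rewrite -e1 -e2 eqxx.
(* The removed edge itself uses one of the [t] edges at each endpoint. *)
have deg x : touch x (i, j) -> (#|[set f in E' | touch x f]| <= t.-1)%N /\ (0 < t)%N.
  move=> tx; have := degG x; rewrite (cardsD1 (i, j)) inE eG tx add1n.
  case: t => // t'; rewrite ltnS => h; split=> //; apply: leq_trans h; apply: subset_leq_card.
  apply/subsetP => f; rewrite !inE => /andP[/andP[-> fE] ->].
  by rewrite (subsetP EG).
have [degi t0] : (#|[set f in E' | touch i f]| <= t.-1)%N /\ (0 < t)%N.
  by apply: deg; rewrite /touch eqxx.
have [degj _] : (#|[set f in E' | touch j f]| <= t.-1)%N /\ (0 < t)%N.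
  by apply: deg; rewrite /touch eqxx orbT.
set w := #|W|.-1.
(* By induction the count is within [4 * #|S|%:R * alpha ^+ w.-1 * theta] of [alpha ^+ w], and
   [alpha_large] bounds this error by [alpha ^+ w]. The deletions of [i] and of [j] together give
   the constant 4. *)
have small x (S : {set 'I_n * 'I_n}) : x \in W -> (0 < w)%N -> S \subset E' ->
    (forall f, f \in S -> ~~ touch x f) ->
    weighted_count len A S (W :\ x) <= 2 * alpha ^+ w.
  move=> xW w0 SE' notx.
  have cW : #|W :\ x| = w by rewrite /w (cardsD1 x W) xW.
  have SE : S \subset E := subset_trans SE' (subD1set _ _).
  have SG : S \subset G := subset_trans SE' sub'.
  have cS : (#|S| <= k)%N.
    by apply: leq_trans (subset_leq_card SE') _; rewrite -ltnS -cE'.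
  have SW f : f \in S -> (f.1 \in W :\ x) && (f.2 \in W :\ x).
    move=> fS; have := notx f fS; rewrite /touch negb_or => /andP[n1 n2].
    by rewrite !inE n1 n2 EW // (subsetP SE).
  have := IH S (W :\ x) cS SG SW; rewrite cW => h.
  have h2 : 4 * #|S|%:R * alpha ^+ w.-1 * theta <= alpha ^+ w.
    rewrite -[w in X in _ <= X](prednK w0) exprS mulrAC ler_wpM2r ?exprn_ge0 //.
    apply: le_trans alpha_large; rewrite ler_wpM2r // ler_wpM2l ?ler0n // ler_nat.
    exact: subset_leq_card.
  have r1 : weighted_count len A S (W :\ x) - alpha ^+ w \is Num.real.
    by rewrite realB // ger0_real ?weighted_count_ge0 ?exprn_ge0.
  have := le_trans (real_ler_norm r1) (le_trans h h2).
  by rewrite lerBlDr -mulr2n mulr_natl.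
have w0 : (0 < w)%N.
  by rewrite /w (cardsD1 i W) iW (cardsD1 j (W :\ i)) !inE jW eq_sym ij.
have [psi psiP] := add_char_exists F.
have lam0 : len i j != 0 := lenG eG.
have err := edge_removal_error A two0 psiP ij iW jW lam0 sep degi degj.
rewrite -EE' in err.
apply: le_trans (ler_distD (weighted_count len A E' W) _ _) _.
have cE'k : (#|E'| <= k)%N by rewrite -ltnS -cE'.
have IH' := IH E' W cE'k sub' EW'.
have notS x f : f \in [set f in E' | ~~ touch x f] -> ~~ touch x f.
  by rewrite inE => /andP[].
have subS x : [set f in E' | ~~ touch x f] \subset E'.
  by apply/subsetP => f; rewrite inE => /andP[].
have sj := small j _ jW w0 (subS j) (notS j).
have si := small i _ iW w0 (subS i) (notS i).
have -> : 4 * #|E|%:R * alpha ^+ w * theta =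
   theta * (2 * alpha ^+ w + 2 * alpha ^+ w) + 4 * #|E'|%:R * alpha ^+ w * theta.
  by rewrite cE' -addn1 natrD; ring.
apply: lerD IH'; apply: le_trans err _.
(* Both sides agree because [sqrtC q ^+ d.+1] squared is [q ^+ d.+1]. *)
have -> : sqrtC q ^+ d.+1 * q ^+ t.-1 / q ^+ d = theta.
  have sn0 : sqrtC q ^+ d.+1 != 0 by rewrite expf_neq0 // gt_eqF.
  have qn0 : q ^+ d != 0 by rewrite expf_neq0 // gt_eqF.
  rewrite /theta; apply/eqP; rewrite eqr_div //; apply/eqP.
  rewrite mulrAC -exprMn -expr2 sqrtCK -!exprD; congr (_ ^+ _).
  by rewrite -[in RHS](prednK t0) addSnnS addnC.
by rewrite ler_wpM2l // lerD.
Qed.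

End CountingError.

(** * Application to the distance graph *)

Definition edges (n : nat) (adj : rel 'I_n) : {set 'I_n * 'I_n} :=
  [set p : 'I_n * 'I_n | (p.1 < p.2)%N && adj p.1 p.2].

(** An edge at [i] is determined by its other endpoint, whose position relative to [i] fixes the
    order of the pair. *)
Lemma card_touching_edges (n : nat) (adj : rel 'I_n) (i : 'I_n) :
  (forall j k, adj j k = adj k j) ->
  (#|[set f in edges adj | touch i f]| <= max_degree adj)%N.
Proof.
move=> sym; apply: (leq_trans _ (leq_bigmax i)); rewrite /degree.
pose other (f : 'I_n * 'I_n) := if f.1 == i then f.2 else f.1.
have inj : {in [set f in edges adj | touch i f] &, injective other}.
  move=> [a b] [a' b']; rewrite !inE /touch /other /= => /andP[/andP[ab _] t1] /andP[/andP[ab' _] t2].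
  move: t1 t2 ab ab'; have [->|_] := eqVneq a i; have [->|_] := eqVneq a' i => /=.
  - by move=> _ _ _ _ ->.
  - by move=> _ /eqP -> lt1 lt2 e; move: lt1; rewrite e ltnNge ltnW.
  - by move=> /eqP -> _ lt1 lt2 e; move: lt1; rewrite e ltnNge ltnW.
  - by move=> /eqP -> /eqP -> _ _ ->.
rewrite -(card_in_imset inj).
apply: subset_leq_card; apply/subsetP => _ /imsetP[[a b] fE ->].
move: fE; rewrite !inE /touch /other /=.
case: (eqVneq a i) => [-> /andP[/andP[_ ?] _]|_ /andP[/andP[_ ?] /eqP<-]] //.
by rewrite sym.
Qed.

Lemma NG_weighted_count (F : finFieldType) (d n : nat) (adj : rel 'I_n)
  (len : 'I_n -> 'I_n -> F) (A : {set 'rV[F]_d}) :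
  NG adj len A = weighted_count len A (edges adj) [set: 'I_n].
Proof.
rewrite /NG /weighted_count; congr (_ * _); apply: eq_bigr => x _.
rewrite big_split /=; congr (_ * _).
  by rewrite /vertex_weight; apply: eq_bigl => k; rewrite inE.
rewrite pair_big_dep /= /edge_weight [RHS]big_mkcond [LHS]big_mkcond /=.
by apply: eq_bigr => -[a b] _; rewrite inE /= /sigma_ij; case: ltnP; case: (adj a b).
Qed.

Theorem theorem5p1 (F : finFieldType) (d n : nat)
  (adj : rel 'I_n) (len : 'I_n -> 'I_n -> F) (A : {set 'rV[F]_d}) (alpha : algC) :
  (1 <= d)%N ->
  ~~ (2 \in [pchar F])%N ->
  distance_graph adj len ->
  (1 <= num_edges adj)%N ->
  (#|A|%:R : algC) = alpha * #|F|%:R ^+ d ->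
  alpha >= 4 * (num_edges adj)%:R * #|F|%:R ^+ (max_degree adj)
             / sqrtC (#|F|%:R) ^+ d.+1 ->
  `| NG adj len A - alpha ^+ n | <=
     4 * (num_edges adj)%:R * alpha ^+ n.-1 * #|F|%:R ^+ (max_degree adj)
             / sqrtC (#|F|%:R) ^+ d.+1.
Proof.
move=> _ ch [irr sym _ len0] _ cA; rewrite -mulrA => large.
have two0 : (2 : F) != 0 by move: ch; rewrite inE.
rewrite NG_weighted_count -mulrA.
have -> : num_edges adj = #|edges adj| by [].
have cT : #|[set: 'I_n]| = n by rewrite cardsT card_ord.
have -> : alpha ^+ n = alpha ^+ #|[set: 'I_n]| by rewrite cT.
have -> : n.-1 = #|[set: 'I_n]|.-1 by rewrite cT.
apply: (weighted_count_error two0 _ _ _ cA large (leqnn _)) => //.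
- by move=> f; rewrite inE => /andP[].
- by move=> f; rewrite inE => /andP[_ /len0].
- by move=> i; apply: card_touching_edges.
- by move=> f _; rewrite !inE.
Qed.
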